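(* Let $(\mathcal{P},\mathcal{G},X,\pi)$ be a principal sheaf whose structure sheaf $\mathcal{G}$ is of Lie-type, and let $\varphi:\mathcal{G}\to\mathcal{GL}(n,\mathcal{A})$ be a representation of Lie-type. Then every connection $D$ on $\mathcal{P}$ induces an $\mathcal{A}$-linear connection $\nabla$ on the vector sheaf $\mathcal{E}$ associated with $\mathcal{P}$ by $\varphi$.
   Context: $X$ is a topological space, $\mathcal{A}$ a sheaf over $X$ of unital, commutative, associative $\mathbb{K}$-algebras ($\mathbb{K}=\mathbb{R},\mathbb{C}$), and $(\mathcal{A},d,\Omega^1)$ a differential triad: $\Omega^1$ is an $\mathcal{A}$-module and $d:\mathcal{A}\to\Omega^1$ is $\mathbb{K}$-linear with $d(s\cdot t)=s\cdot d(t)+t\cdot d(s)$ for local sections $s,t$. Principal sheaf $(\mathcal{P},\mathcal{G},X,\pi)$: a sheaf of sets $\mathcal{P}$ over $X$ with projection $\pi$, a sheaf of groups $\mathcal{G}$, a right action $\mathcal{P}\times_X\mathcal{G}\to\mathcal{P}$, and an open covering $\mathcal{U}=\{U_\alpha\mid\alpha\in I\}$ of $X$ with $\mathcal{G}$-equivariant isomorphisms $\phi_\alpha:\mathcal{P}|_{U_\alpha}\to\mathcal{G}|_{U_\alpha}$. Natural sections: $s_\alpha:=\phi_\alpha^{-1}\circ\mathbf 1|_{U_\alpha}\in\mathcal{P}(U_\alpha)$, $\mathbf 1$ the unit section of $\mathcal{G}$. $\mathcal{G}$ is of Lie-type if it is equipped with (i) a representation (continuous morphism of sheaves of groups) $\varrho:\mathcal{G}\to\mathcal{A}ut(\mathcal{L})$,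 where $\mathcal{L}$ is an $\mathcal{A}$-module of Lie algebras, and (ii) a morphism of sheaves of sets $\partial:\mathcal{G}\to\Omega^1\otimes_{\mathcal{A}}\mathcal{L}$ (Maurer-Cartan differential) with $\partial(s\cdot t)=\varrho(t^{-1}).\partial(s)+\partial(t)$ for all $s,t\in\mathcal{G}(U)$, $U\subseteq X$ open. Here $\varrho(g).\omega:=(1\otimes\varrho(g))(\omega)$, i.e. $\varrho(g).(\theta\otimes u)=\theta\otimes\varrho(g)(u)$ extended linearly, $1=\mathrm{id}_{\Omega^1}$. $\mathcal{GL}(n,\mathcal{A})$ is the sheaf of groups with $\mathcal{GL}(n,\mathcal{A})(U)\cong GL(n,\mathcal{A}(U))$; $M_n(\mathcal{A})$ is the sheaf of Lie algebras with $M_n(\mathcal{A})(U)\cong M_n(\mathcal{A}(U))$. $\mathcal{A}d:\mathcal{GL}(n,\mathcal{A})\to\mathcal{A}ut(M_n(\mathcal{A}))$ is $\mathcal{A}d(g)(a)=g\cdot a\cdot g^{-1}$, and $\widetilde\partial:\mathcal{GL}(n,\mathcal{A})\to\Omega^1\otimes_{\mathcal{A}}M_n(\mathcal{A})$ is $\widetilde\partial(a)=a^{-1}\cdot(da_{ij})$ for $a=(a_{ij})\in GL(n,\mathcal{A}(U))$, with the identification $(\Omega^1\otimes_{\mathcal{A}}M_n(\mathcal{A}))(U)\cong M_n(\Omega^1(U))$. These make $\mathcal{GL}(n,\mathcal{A})$ of Lie-type. A representation $\varphi:\mathcal{G}\to\mathcal{GL}(n,\mathcal{A})$ (a continuous morphism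 of sheaves of groups) is of Lie-type if there is an ($\mathcal{A}$-linear) morphism of sheaves of Lie algebras $\overline{\varphi}:\mathcal{L}\to M_n(\mathcal{A})$ such that $\widetilde\partial\circ\varphi=(1\otimes\overline\varphi)\circ\partial$ and $\overline\varphi\circ\varrho(g)=\mathcal{A}d(\varphi(g))\circ\overline\varphi$ for all $g\in\mathcal{G}$. Associated vector sheaf $\mathcal{E}$: the sheaf generated by the presheaf $U\mapsto Q(U)$, where $Q(U)$ is the quotient of $\mathcal{P}(U)\times\mathcal{A}^n(U)$ by $(s,a)\sim(t,b)\iff\exists!\,g\in\mathcal{G}(U)$: $t=s\cdot g$, $b=\varphi(g^{-1})\cdot a$. The maps $f\mapsto[s_\alpha|_V,f]$ ($V\subseteq U_\alpha$ open, $f\in\mathcal{A}^n(V)$) generate isomorphisms $\psi_\alpha:\mathcal{A}^n|_{U_\alpha}\to\mathcal{E}|_{U_\alpha}$, and $\mathcal{E}$ has the (well-defined) $\mathcal{A}$-module structure for which all $\psi_\alpha$ are $\mathcal{A}|_{U_\alpha}$-linear; it is a vector sheaf (locally free $\mathcal{A}$-module) of rank $n$. A connection on $\mathcal{P}$ is a morphism of sheaves of sets $D:\mathcal{P}\to\Omega^1\otimes_{\mathcal{A}}\mathcal{L}$ with $D(s\cdot g)=\varrho(g^{-1}).D(s)+\partial(g)$ for all $s\in\mathcal{P}(U)$, $g\in\mathcal{G}(U)$, $U$ open. Its local connection forms are $\omega_\alpha:=D(s_\alpha)\in(\Omega^1\otimes_{\mathcal{A}}\mathcal{L})(U_\alpha)$.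 An $\mathcal{A}$-(linear) connection on $\mathcal{E}$ is a $\mathbb{K}$-linear morphism $\nabla:\mathcal{E}\to\mathcal{E}\otimes_{\mathcal{A}}\Omega^1$ with $\nabla(a\cdot s)=a\cdot\nabla(s)+s\otimes d(a)$ for $a\in\mathcal{A}(U)$, $s\in\mathcal{E}(U)$. Let $e^\alpha=(e^\alpha_1,\dots,e^\alpha_n)$ be the basis of $\mathcal{E}(U_\alpha)$ that is the image under $\psi_\alpha$ of the standard basis. The local connection forms $\theta_\alpha=(\theta^\alpha_{ij})\in M_n(\Omega^1(U_\alpha))\cong(\Omega^1\otimes_{\mathcal{A}}M_n(\mathcal{A}))(U_\alpha)$ of $\nabla$ are given by $\nabla(e^\alpha_j)=\sum_{i=1}^n e^\alpha_i\otimes\theta^\alpha_{ij}$. ''$D$ induces $\nabla$'' means: $\nabla$ is the $\mathcal{A}$-connection on $\mathcal{E}$ whose local connection forms are $\theta_\alpha=(1\otimes\overline\varphi)(\omega_\alpha)$, $\alpha\in I$. *)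

(* Defs.v *)
From HB Require Import structures.
From mathcomp Require Import all_boot all_order all_algebra.
From mathcomp Require Import boolp classical_sets reals topology.
From mathcomp Require Import complex.
From Corelib Require Import RelationClasses.

Set Implicit Arguments.
Unset Strict Implicit.
Unset Printing Implicit Defensive.

Import GRing.Theory.
Local Open Scope classical_set_scope.
Local Open Scope ring_scope.

Inductive real_or_complex (R : realType) : fieldType -> Prop :=
  | is_real : real_or_complex R R
  | is_complex : real_or_complex R R[i].

Section Quotient.
Variables (T : Type) (e : T -> T -> Prop).

Definition quot := {C : set T | exists x, C = e x}.

Definition cls (x : T) : quot := exist _ (e x : set T) (ex_intro _ x erefl).

Definition repr (q : quot) : T := sval (cid (svalP q)).

Lemma reprK q : cls (repr q) = q.
Proof.
have quot_eq (a b : quot) : sval a = sval b -> a = b.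
  by case: a b => C hC [D hD] /= eCD; exact: eq_exist.
by apply: quot_eq; rewrite /= /repr -(svalP (cid (svalP q))).
Qed.

Lemma cls_eq : Equivalence e -> forall x y, cls x = cls y <-> e x y.
Proof.
case=> er es et x y; split => [/(congr1 sval)/= exy|exy].
  by rewrite exy; exact: er.
apply: eq_exist; apply/funext => z; apply/propext; split => h.
- by apply: et (es _ _ exy) h.
- by apply: et exy h.
Qed.

Lemma repr_cls : Equivalence e -> forall x, e (repr (cls x)) x.
Proof. by move=> ee x; apply/(cls_eq ee); rewrite reprK. Qed.

End Quotient.
Arguments cls {T} e x.

Section Opens.
Variable X : topologicalType.

Record opens := Opens {
  open_set :> X -> Prop;
  open_setP : open (open_set : set X) }.

Definition openI (U V : opens) : opens :=
  Opens (openI (open_setP U) (open_setP V)).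

Lemma openIl (U V : opens) : openI U V `<=` U. Proof. by move=> x []. Qed.
Lemma openIr (U V : opens) : openI U V `<=` V. Proof. by move=> x []. Qed.
Lemma openI_sub (U V W : opens) : W `<=` U -> W `<=` V -> W `<=` openI U V.
Proof. by move=> h k x Wx; split; [exact: h | exact: k]. Qed.

End Opens.
Arguments openIl {X U V}.
Arguments openIr {X U V}.

Section SheafAxioms.
Variables (X : topologicalType) (F : opens X -> Type).
Variable res : forall U V : opens X, V `<=` U -> F U -> F V.

Record is_presheaf : Prop := IsPresheaf {
  res_id : forall (U : opens X) (h : U `<=` U) (s : F U), res h s = s;
  res_comp : forall (U V W : opens X) (h : V `<=` U) (k : W `<=` V)
    (l : W `<=` U) (s : F U), res k (res h s) = res l s }.

Record is_sheaf : Prop := IsSheaf {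
  sheaf_presheaf :> is_presheaf;
  sheaf_glue : forall (U : opens X) (I : Type) (V : I -> opens X)
      (VU : forall i, V i `<=` U) (s : forall i, F (V i)),
    (forall x, U x -> exists i, V i x) ->
    (forall i j (W : opens X) (hi : W `<=` V i) (hj : W `<=` V j),
      res hi (s i) = res hj (s j)) ->
    exists! t : F U, forall i, res (VU i) t = s i }.

End SheafAxioms.
Arguments sheaf_glue {X F res} _ {U I V} VU s.

Record presheaf (X : topologicalType) := Presheaf {
  psec :> opens X -> Type;
  pres : forall U V : opens X, V `<=` U -> psec U -> psec V;
  presP : is_presheaf pres }.

Arguments pres {X p U V}.

Record setSheaf (X : topologicalType) := SetSheaf {
  sh_sec :> opens X -> Type;
  sh_res : forall U V : opens X, V `<=` U -> sh_sec U -> sh_sec V;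
  shP : is_sheaf sh_res }.

Arguments sh_res {X s U V}.

(* The group of sections over the empty set is trivial, likewise for modules
   and rings: hence the structures [comPzRingType] below, in which 1 = 0 is
   allowed. *)
Record groupSheaf (X : topologicalType) := GroupSheaf {
  gs_sec :> opens X -> groupType;
  gs_res : forall U V : opens X, V `<=` U -> {multiplicative gs_sec U -> gs_sec V};
  gsP : is_sheaf (fun U V h => gs_res h : gs_sec U -> gs_sec V) }.

Arguments gs_res {X g U V}.

(* A commutative unital associative K-algebra is a commutative ring [R] with a
   ring morphism [K -> R]; the scalar action is [k * s := alg_in k * s]. *)
Record algSheaf (K : fieldType) (X : topologicalType) := AlgSheaf {
  alg_sec :> opens X -> comPzRingType;
  alg_in : forall U, {rmorphism K -> alg_sec U};
  alg_res : forall U V : opens X, V `<=` U -> {rmorphism alg_sec U -> alg_sec V};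
  alg_res_in : forall (U V : opens X) (h : V `<=` U) k, alg_res h (alg_in U k) = alg_in V k;
  algP : is_sheaf (fun U V h => alg_res h : alg_sec U -> alg_sec V) }.

Arguments alg_in {K X} a U.
Arguments alg_res {K X a U V}.

Section Modules.
Variables (K : fieldType) (X : topologicalType) (A : algSheaf K X).

Record modPresheaf := ModPresheaf {
  mod_sec :> forall U, lmodType (A U);
  mod_res : forall U V : opens X, V `<=` U -> {additive mod_sec U -> mod_sec V};
  mod_resZ : forall (U V : opens X) (h : V `<=` U) (a : A U) (m : mod_sec U),
    mod_res h (a *: m) = alg_res h a *: mod_res h m;
  modP : is_presheaf (fun U V h => mod_res h : mod_sec U -> mod_sec V) }.

Arguments mod_res {_ U V}.

Record modSheaf := ModSheaf {
  ms_pre :> modPresheaf;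
  msP : is_sheaf (fun U V h => mod_res h : ms_pre U -> ms_pre V) }.

Definition mod_presheaf (M : modPresheaf) : presheaf X :=
  @Presheaf X (fun U => M U) (fun U V h => mod_res h) (modP M).

Record modHomOn (U : opens X) (M N : modPresheaf) := ModHomOn {
  mho_fun :> forall V : opens X, V `<=` U -> {linear M V -> N V};
  mho_nat : forall (V W : opens X) (hV : V `<=` U) (hW : W `<=` U)
    (h : W `<=` V) (m : M V),
    mod_res h (mho_fun hV m) = mho_fun hW (mod_res h m) }.

Record modHom (M N : modPresheaf) := ModHom {
  mh_fun :> forall V : opens X, {linear M V -> N V};
  mh_nat : forall (V W : opens X) (h : W `<=` V) (m : M V),
    mod_res h (mh_fun V m) = mh_fun W (mod_res h m) }.

Definition modHom_on (U : opens X) (M N : modPresheaf) (f : modHom M N) :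
    modHomOn U M N :=
  @ModHomOn U M N (fun V _ => f V) (fun V W _ _ h m => mh_nat f h m).

End Modules.
Arguments mod_res {K X A _ U V}.

(* The sheaf generated by a presheaf: its sections over U are the continuous
   sections over U of the projection of the disjoint union of the stalks,
   i.e. the families of germs that are locally given by a section of F. *)
Section Sheafification.
Variables (X : topologicalType) (F : presheaf X).

Section Stalk.
Variable x : X.

Record nbhd_sec := NbhdSec {
  ns_open : opens X;
  ns_in : ns_open x;
  ns_sec : F ns_open }.

Definition germ_rel (p q : nbhd_sec) : Prop :=
  exists (W : opens X) (hp : W `<=` ns_open p) (hq : W `<=` ns_open q),
    W x /\ pres hp (ns_sec p) = pres hq (ns_sec q).

Lemma germ_rel_equiv : Equivalence germ_rel.
Proof.
split.
- by case=> U Ux s; exists U, (@subset_refl _ _), (@subset_refl _ _).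
- by move=> p q [W [hp [hq [Wx e]]]]; exists W, hq, hp.
- move=> p q r [W [hp [hq [Wx e]]]] [W' [hq' [hr [W'x e']]]].
  pose Z := openI W W'.
  have Zp : Z `<=` ns_open p by apply: subset_trans openIl hp.
  have Zq : Z `<=` ns_open q by apply: subset_trans openIl hq.
  have Zr : Z `<=` ns_open r by apply: subset_trans openIr hr.
  exists Z, Zp, Zr; split => //.
  rewrite -(res_comp (presP F) hp openIl) e (res_comp (presP F) hq openIl Zq).
  rewrite -(res_comp (presP F) hr openIr) -e'.
  by rewrite (res_comp (presP F) hq' openIr Zq).
Qed.

Definition stalk := quot germ_rel.

Definition germ (U : opens X) (Ux : U x) (s : F U) : stalk :=
  cls germ_rel (NbhdSec Ux s).

Lemma germ_eq (U : opens X) (Ux : U x) (s : F U) (V : opens X) (Vx : V x) (t : F V) :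
  germ Ux s = germ Vx t <->
  exists (W : opens X) (hU : W `<=` U) (hV : W `<=` V),
    W x /\ pres hU s = pres hV t.
Proof. exact: (cls_eq germ_rel_equiv). Qed.

Lemma germ_res (U V : opens X) (h : V `<=` U) (Ux : U x) (Vx : V x) (s : F U) :
  germ Vx (pres h s) = germ Ux s.
Proof.
apply/germ_eq; exists V, (@subset_refl _ _), h; split => //.
by rewrite (res_id (presP F)).
Qed.

Lemma germP (g : stalk) : exists (U : opens X) (Ux : U x) (s : F U), g = germ Ux s.
Proof.
rewrite -(reprK g); case: (repr g) => U Ux s.
by exists U, Ux, s.
Qed.

Lemma germP2 (g h : stalk) : exists (U : opens X) (Ux : U x) (s t : F U),
  g = germ Ux s /\ h = germ Ux t.
Proof.
have [U [Ux [s ->]]] := germP g; have [V [Vx [t ->]]] := germP h.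
have Wx : openI U V x by [].
exists (openI U V), Wx, (pres openIl s), (pres openIr t).
by rewrite !germ_res.
Qed.

End Stalk.

Record gen_sec (U : opens X) := GenSec {
  gsec_fun :> forall x, U x -> stalk x;
  gsec_loc : forall x, U x -> exists (V : opens X) (VU : V `<=` U) (s : F V),
    V x /\ forall y (Vy : V y), gsec_fun (VU y Vy) = germ Vy s }.

Lemma gen_sec_eq U (s t : gen_sec U) :
  (forall x (Ux : U x), s x Ux = t x Ux) -> s = t.
Proof.
case: s t => [s hs] [t ht] /= e.
have est : s = t by apply: functional_extensionality_dep => x; apply: functional_extensionality_dep.
by subst t; congr GenSec; exact: Prop_irrelevance.
Qed.

Fact gen_res_loc (U V : opens X) (h : V `<=` U) (s : gen_sec U) x :
  V x -> exists (W : opens X) (WV : W `<=` V) (t : F W),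
    W x /\ forall y (Wy : W y), s y (h y (WV y Wy)) = germ Wy t.
Proof.
move=> Vx; have [W [WU [t [Wx e]]]] := gsec_loc s (h x Vx).
exists (openI W V), openIr, (pres openIl t); split => // y Wy.
rewrite (germ_res _ Wy.1) -e; congr (gsec_fun s _); exact: Prop_irrelevance.
Qed.

Definition gen_res (U V : opens X) (h : V `<=` U) (s : gen_sec U) : gen_sec V :=
  @GenSec V (fun x Vx => s x (h x Vx)) (gen_res_loc h s).

Fact gen_sheaf_axiom : is_sheaf gen_res.
Proof.
split; first split.
- move=> U h s; apply: gen_sec_eq => x Ux /=.
  congr (gsec_fun s _); exact: Prop_irrelevance.
- move=> U V W h k l s; apply: gen_sec_eq => x Ux /=.
  congr (gsec_fun s _); exact: Prop_irrelevance.
move=> U I V VU s cov comp.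
pose i_ x Ux := sval (cid (cov x Ux)).
have iP x Ux : V (i_ x Ux) x by exact: svalP (cid (cov x Ux)).
have sE i j x (Vi : V i x) (Vj : V j x) : s i x Vi = s j x Vj.
  have /(congr1 (fun t => gsec_fun t (conj Vi Vj : openI (V i) (V j) x))) /=
    := comp i j _ openIl openIr.
  rewrite (Prop_irrelevance (openIl _ _) Vi).
  by rewrite (Prop_irrelevance (openIr _ _) Vj).
have tloc x : U x -> exists (W : opens X) (WU : W `<=` U) (t : F W),
    W x /\ forall y (Wy : W y),
      s (i_ y (WU y Wy)) y (iP y (WU y Wy)) = germ Wy t.
  move=> Ux; have [W [WV [t [Wx e]]]] := gsec_loc (s (i_ x Ux)) (iP x Ux).
  have WU : W `<=` U by apply: subset_trans WV (VU _).
  exists W, WU, t; split => // y Wy.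
  by rewrite -e; exact: sE.
exists (@GenSec U (fun x Ux => s (i_ x Ux) x (iP x Ux)) tloc); split.
  by move=> i; apply: gen_sec_eq => x Vx /=; exact: sE.
move=> t tE; apply: gen_sec_eq => x Ux /=.
rewrite -tE /=; congr (gsec_fun t _); exact: Prop_irrelevance.
Qed.

Definition gen_sheaf : setSheaf X := SetSheaf gen_sheaf_axiom.

Fact eta_loc (U : opens X) (s : F U) x :
  U x -> exists (V : opens X) (VU : V `<=` U) (t : F V),
    V x /\ forall y (Vy : V y), germ (VU y Vy) s = germ Vy t.
Proof. by move=> Ux; exists U, (fun _ h => h), s. Qed.

Definition eta (U : opens X) (s : F U) : gen_sec U :=
  @GenSec U (fun x Ux => germ Ux s) (eta_loc s).

Lemma eta_res (U V : opens X) (h : V `<=` U) (s : F U) : gen_res h (eta s) = eta (pres h s).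
Proof. by apply: gen_sec_eq => x Vx /=; rewrite (germ_res h (h x Vx)). Qed.

Lemma eta_eq U (s t : F U) : eta s = eta t <-> forall x, U x ->
  exists (W : opens X) (h : W `<=` U), W x /\ pres h s = pres h t.
Proof.
split => [/(congr1 (@gsec_fun U)) e x Ux|e].
  have := congr1 (fun f => f x Ux) e => /germ_eq[W [hU [hV [Wx {}e]]]].
  by exists W, hU; split => //; rewrite e; congr pres; exact: Prop_irrelevance.
apply: gen_sec_eq => x Ux; apply/germ_eq.
by have [W [h [Wx {}e]]] := e x Ux; exists W, h, h.
Qed.

Lemma eta_loc_surj U (s : gen_sec U) x : U x ->
  exists (V : opens X) (h : V `<=` U) (t : F V), V x /\ gen_res h s = eta t.
Proof.
move=> Ux; have [V [h [t [Vx e]]]] := gsec_loc s Ux.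
by exists V, h, t; split => //; apply: gen_sec_eq.
Qed.

End Sheafification.

Section SheafificationMap.
Variables (X : topologicalType) (F F' : presheaf X) (U : opens X).
Variable f : forall V : opens X, V `<=` U -> F V -> F' V.
Hypothesis f_nat : forall (V W : opens X) (hV : V `<=` U) (hW : W `<=` U)
  (h : W `<=` V) (s : F V), pres h (f hV s) = f hW (pres h s).

Definition stalk_map x (Ux : U x) (g : stalk F x) : stalk F' x :=
  let p := repr g in
  germ (conj (ns_in p) Ux : openI (ns_open p) U x)
    (f openIr (pres openIl (ns_sec p))).

Lemma stalk_mapE x (Ux : U x) (V : opens X) (hV : V `<=` U) (Vx : V x)
  (s : F V) : stalk_map Ux (germ Vx s) = germ Vx (f hV s).
Proof.
rewrite /stalk_map; have := repr_cls (germ_rel_equiv F x) (NbhdSec Vx s).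
rewrite -/(germ Vx s); case: (repr _) => W Wx t [/= Z [hp [hq [Zx e]]]].
have ZU : Z `<=` U by apply: subset_trans hq hV.
apply/germ_eq; exists Z, (openI_sub hp ZU), hq; split => //.
by rewrite !(f_nat _ ZU) (res_comp (presP F) _ _ hp) e.
Qed.

Fact gen_map_loc (s : gen_sec F U) x :
  U x -> exists (V : opens X) (VU : V `<=` U) (t : F' V),
    V x /\ forall y (Vy : V y), stalk_map (VU y Vy) (s y (VU y Vy)) = germ Vy t.
Proof.
move=> Ux; have [V [VU [t [Vx e]]]] := gsec_loc s Ux.
exists V, VU, (f VU t); split => // y Vy.
by rewrite e (stalk_mapE _ VU).
Qed.

Definition gen_map (s : gen_sec F U) : gen_sec F' U :=
  @GenSec X F' U (fun x Ux => stalk_map Ux (s x Ux)) (gen_map_loc s).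

End SheafificationMap.

Section ModSheafification.
Variables (K : fieldType) (X : topologicalType) (A : algSheaf K X).
Variable M : modPresheaf A.
Let F := mod_presheaf M.

Section StalkOps.
Variable x : X.

Definition stalk_add (g h : stalk F x) : stalk F x :=
  let p := repr g in let q := repr h in
  germ (conj (ns_in p) (ns_in q) : openI (ns_open p) (ns_open q) x)
    (mod_res openIl (ns_sec p) + mod_res openIr (ns_sec q) : F _).

Lemma stalk_addE (U : opens X) (Ux : U x) (s t : M U) :
  stalk_add (germ Ux (s : F U)) (germ Ux (t : F U)) = germ Ux (s + t : F U).
Proof.
rewrite /stalk_add.
have := repr_cls (germ_rel_equiv F x) (NbhdSec Ux (s : F U)).
have := repr_cls (germ_rel_equiv F x) (NbhdSec Ux (t : F U)).
rewrite -!/(germ Ux _).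
case: (repr _) => V Vx b [/= W [hV [hU [Wx e]]]].
case: (repr _) => V' V'x b' [/= W' [hV' [hU' [W'x e']]]].
pose Z := openI W' W.
have Zi : Z `<=` openI V' V.
  by apply: openI_sub; [apply: subset_trans openIl hV'|apply: subset_trans openIr hV].
have ZU : Z `<=` U by apply: subset_trans openIr hU.
apply/germ_eq; exists Z, Zi, ZU; split => //=.
rewrite !raddfD /=; congr (_ + _).
- rewrite (res_comp (modP M) _ _ (subset_trans openIl hV')).
  rewrite -(res_comp (modP M) hV' openIl) e'.
  exact: (res_comp (modP M)).
- rewrite (res_comp (modP M) _ _ (subset_trans openIr hV)).
  rewrite -(res_comp (modP M) hV openIr) e.
  exact: (res_comp (modP M)).
Qed.

Definition stalk_opp (g : stalk F x) : stalk F x :=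
  let p := repr g in germ (ns_in p) (- (ns_sec p : M _) : F _).

Lemma stalk_oppE (U : opens X) (Ux : U x) (s : M U) :
  stalk_opp (germ Ux (s : F U)) = germ Ux (- s : F U).
Proof.
rewrite /stalk_opp.
have := repr_cls (germ_rel_equiv F x) (NbhdSec Ux (s : F U)).
rewrite -!/(germ Ux _).
case: (repr _) => V Vx b [/= W [hV [hU [Wx e]]]].
apply/germ_eq; exists W, hV, hU; split => //=.
by rewrite !raddfN; congr (- _).
Qed.

Definition stalk_scale (U : opens X) (Ux : U x) (a : A U) (g : stalk F x) : stalk F x :=
  let p := repr g in
  germ (conj (ns_in p) Ux : openI (ns_open p) U x)
    (alg_res openIr a *: mod_res openIl (ns_sec p) : F _).

Lemma stalk_scaleE (U : opens X) (Ux : U x) (a : A U) (V : opens X) (VU : V `<=` U) (Vx : V x) (s : M V) :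
  stalk_scale Ux a (germ Vx (s : F V)) = germ Vx (alg_res VU a *: s : F V).
Proof.
rewrite /stalk_scale.
have := repr_cls (germ_rel_equiv F x) (NbhdSec Vx (s : F V)).
rewrite -!/(germ Vx _).
case: (repr _) => W Wx b [/= Z [hW [hV [Zx e]]]].
have Zi : Z `<=` openI W U.
  by apply: openI_sub => //; apply: subset_trans hV VU.
apply/germ_eq; exists Z, Zi, hV; split => //=.
rewrite !mod_resZ /=; congr (_ *: _).
  rewrite (res_comp (algP A) _ _ (subset_trans hV VU)).
  by rewrite (res_comp (algP A) _ _ (subset_trans hV VU)).
by rewrite (res_comp (modP M) _ _ hW).
Qed.

End StalkOps.

Definition genmod_sec (U : opens X) := gen_sec F U.

HB.instance Definition _ U := gen_eqMixin (genmod_sec U).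
HB.instance Definition _ U := gen_choiceMixin (genmod_sec U).

Section Ops.
Variable U : opens X.
Implicit Types s t : genmod_sec U.

Definition genmod_zero : genmod_sec U := @eta X F U (0 : M U).

Lemma gsec_loc2 s t x : U x ->
  exists (V : opens X) (VU : V `<=` U) (b c : F V), V x /\
   forall y (Vy : V y), s y (VU y Vy) = germ Vy b /\ t y (VU y Vy) = germ Vy c.
Proof.
move=> Ux; have [V [VU [b [Vx e]]]] := gsec_loc s Ux.
have [W [WU [c [Wx e']]]] := gsec_loc t Ux.
exists (openI V W), (subset_trans openIl VU), (pres openIl b), (pres openIr c).
split => // y Zy; rewrite (germ_res _ Zy.1) (germ_res _ Zy.2) -e -e'.
by split; congr (gsec_fun _ _); exact: Prop_irrelevance.
Qed.

Fact genmod_add_loc s t x : U x ->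
  exists (V : opens X) (VU : V `<=` U) (b : F V), V x /\ forall y (Vy : V y),
    stalk_add (s y (VU y Vy)) (t y (VU y Vy)) = germ Vy b.
Proof.
move=> /(gsec_loc2 s t)[V [VU [b [c [Vx e]]]]].
exists V, VU, ((b : M V) + (c : M V)); split => // y Vy.
by have [-> ->] := e y Vy; rewrite stalk_addE.
Qed.

Definition genmod_add s t : genmod_sec U :=
  @GenSec X F U (fun x Ux => stalk_add (s x Ux) (t x Ux)) (genmod_add_loc s t).

Fact genmod_opp_loc s x : U x ->
  exists (V : opens X) (VU : V `<=` U) (b : F V), V x /\ forall y (Vy : V y),
    stalk_opp (s y (VU y Vy)) = germ Vy b.
Proof.
move=> /(gsec_loc s)[V [VU [b [Vx e]]]].
by exists V, VU, (- (b : M V)); split => // y Vy; rewrite e stalk_oppE.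
Qed.

Definition genmod_opp s : genmod_sec U :=
  @GenSec X F U (fun x Ux => stalk_opp (s x Ux)) (genmod_opp_loc s).

Fact genmod_scale_loc (a : A U) s x : U x ->
  exists (V : opens X) (VU : V `<=` U) (b : F V), V x /\ forall y (Vy : V y),
    stalk_scale (VU y Vy) a (s y (VU y Vy)) = germ Vy b.
Proof.
move=> /(gsec_loc s)[V [VU [b [Vx e]]]].
exists V, VU, (alg_res VU a *: (b : M V)); split => // y Vy.
by rewrite e (stalk_scaleE _ _ VU).
Qed.

Definition genmod_scale (a : A U) s : genmod_sec U :=
  @GenSec X F U (fun x Ux => stalk_scale Ux a (s x Ux)) (genmod_scale_loc a s).

Lemma gsec_germ s x (Ux : U x) : exists (V : opens X) (VU : V `<=` U) (Vx : V x)
  (b : M V), s x Ux = germ Vx (b : F V).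
Proof.
have [V [VU [b [Vx e]]]] := gsec_loc s Ux.
exists V, VU, Vx, b; rewrite -e; congr (gsec_fun s _); exact: Prop_irrelevance.
Qed.

Lemma gsec_germ2 s t x (Ux : U x) :
  exists (V : opens X) (VU : V `<=` U) (Vx : V x) (b c : M V),
    s x Ux = germ Vx (b : F V) /\ t x Ux = germ Vx (c : F V).
Proof.
have [V [VU [b [c [Vx e]]]]] := gsec_loc2 s t Ux.
exists V, VU, Vx, b, c; have [<- <-] := e x Vx.
by split; congr (gsec_fun _ _); exact: Prop_irrelevance.
Qed.

Lemma genmod_addC : commutative genmod_add.
Proof.
move=> s t; apply: gen_sec_eq => x Ux /=.
have [V [_ [Vx [b [c [-> ->]]]]]] := gsec_germ2 s t Ux.
by rewrite !stalk_addE addrC.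
Qed.

Lemma genmod_addA : associative genmod_add.
Proof.
move=> s t r; apply: gen_sec_eq => x Ux /=.
have [V [_ [Vx [b [c [-> ->]]]]]] := gsec_germ2 s t Ux.
have [W [_ [Wx [d ->]]]] := gsec_germ r Ux.
have Zx : openI V W x by [].
rewrite -(germ_res openIl Vx Zx) -(germ_res openIl Vx Zx) -(germ_res openIr Wx Zx).
by rewrite !stalk_addE addrA.
Qed.

Lemma genmod_add0 : left_id genmod_zero genmod_add.
Proof.
move=> s; apply: gen_sec_eq => x Ux /=.
have [V [VU [Vx [b ->]]]] := gsec_germ s Ux.
by rewrite -(germ_res VU Ux Vx) /= raddf0 stalk_addE add0r.
Qed.

Lemma genmod_addN : left_inverse genmod_zero genmod_opp genmod_add.
Proof.
move=> s; apply: gen_sec_eq => x Ux /=.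
have [V [VU [Vx [b ->]]]] := gsec_germ s Ux.
by rewrite -(germ_res VU Ux Vx) /= raddf0 stalk_oppE stalk_addE addNr.
Qed.

HB.instance Definition _ := GRing.isZmodule.Build (genmod_sec U)
  genmod_addA genmod_addC genmod_add0 genmod_addN.

Lemma genmod_scaleA a b s :
  genmod_scale a (genmod_scale b s) = genmod_scale (a * b) s.
Proof.
apply: gen_sec_eq => x Ux /=; have [V [VU [Vx [c ->]]]] := gsec_germ s Ux.
by rewrite !(stalk_scaleE _ _ VU) scalerA rmorphM.
Qed.

Lemma genmod_scale1 : left_id 1 genmod_scale.
Proof.
move=> s; apply: gen_sec_eq => x Ux /=; have [V [VU [Vx [c ->]]]] := gsec_germ s Ux.
by rewrite !(stalk_scaleE _ _ VU) rmorph1 scale1r.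
Qed.

Lemma genmod_scaleDr : right_distributive genmod_scale +%R.
Proof.
move=> a s t; apply: gen_sec_eq => x Ux /=.
have [V [VU [Vx [b [c [-> ->]]]]]] := gsec_germ2 s t Ux.
by rewrite stalk_addE !(stalk_scaleE _ _ VU) stalk_addE scalerDr.
Qed.

Lemma genmod_scaleDl s : {morph genmod_scale^~ s : a b / a + b}.
Proof.
move=> a b; apply: gen_sec_eq => x Ux /=.
have [V [VU [Vx [c ->]]]] := gsec_germ s Ux.
by rewrite !(stalk_scaleE _ _ VU) stalk_addE rmorphD scalerDl.
Qed.

HB.instance Definition _ := GRing.Zmodule_isLmodule.Build (A U) (genmod_sec U)
  genmod_scaleA genmod_scale1 genmod_scaleDr genmod_scaleDl.

End Ops.

Definition genmod_res (U V : opens X) (h : V `<=` U) :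
  genmod_sec U -> genmod_sec V := @gen_res X F U V h.

Fact genmod_res_additive (U V : opens X) (h : V `<=` U) : zmod_morphism (genmod_res h).
Proof.
move=> s t; apply: gen_sec_eq => x Vx /=.
by [].
Qed.

HB.instance Definition _ (U V : opens X) (h : V `<=` U) :=
  GRing.isZmodMorphism.Build (genmod_sec U) (genmod_sec V) (genmod_res h)
    (genmod_res_additive h).

Fact genmod_resZ (U V : opens X) (h : V `<=` U) (a : A U) (s : genmod_sec U) :
  genmod_res h (a *: s) = alg_res h a *: genmod_res h s.
Proof.
apply: gen_sec_eq => x Vx /=.
have [W [WV [Wx [c e]]]] := gsec_germ (genmod_res h s) Vx.
rewrite /= in e; rewrite e (stalk_scaleE _ _ WV).
rewrite (stalk_scaleE _ _ (subset_trans WV h)).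
by rewrite (res_comp (algP A) h WV (subset_trans WV h)).
Qed.

Definition genmod_pre : modPresheaf A :=
  @ModPresheaf K X A (fun U => genmod_sec U) (fun U V h => genmod_res h)
    genmod_resZ (gen_sheaf_axiom F).

Definition genmod : modSheaf A := @ModSheaf K X A genmod_pre (gen_sheaf_axiom F).

End ModSheafification.

Section Tensor.
Variables (R : comPzRingType) (M N : lmodType R).

(* M (x)_R N as formal finite sums of pure tensors, modulo the congruence
   generated by commutativity of the sum and R-balanced biadditivity. *)
Inductive tens_eq : seq (M * N) -> seq (M * N) -> Prop :=
| TensRefl s : tens_eq s s
| TensSym s t : tens_eq s t -> tens_eq t s
| TensTrans s t r : tens_eq s t -> tens_eq t r -> tens_eq s r
| TensCat s s' t t' : tens_eq s s' -> tens_eq t t' -> tens_eq (s ++ t) (s' ++ t')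
| TensC s t : tens_eq (s ++ t) (t ++ s)
| Tens0 n : tens_eq [:: (0, n)] [::]
| TensDl m m' n : tens_eq [:: (m + m', n)] [:: (m, n); (m', n)]
| TensDr m n n' : tens_eq [:: (m, n + n')] [:: (m, n); (m, n')]
| TensZ a m n : tens_eq [:: (a *: m, n)] [:: (m, a *: n)].

Lemma tens_eq_equiv : Equivalence tens_eq.
Proof. by split; [exact: TensRefl | exact: TensSym | exact: TensTrans]. Qed.

Definition tensor := quot tens_eq.

End Tensor.

Section TensorMap.
Variables (R R' : comPzRingType) (sigma : R -> R').
Variables (M N : lmodType R) (M' N' : lmodType R').
Variables (f : {additive M -> M'}) (g : {additive N -> N'}).
Hypothesis fZ : forall a m, f (a *: m) = sigma a *: f m.
Hypothesis gZ : forall a n, g (a *: n) = sigma a *: g n.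

Lemma tens_eq_map s t : tens_eq s t ->
  tens_eq [seq (f p.1, g p.2) | p <- s] [seq (f p.1, g p.2) | p <- t].
Proof.
elim => {s t} /=.
- by move=> s; exact: TensRefl.
- by move=> s t _; exact: TensSym.
- by move=> s t r _ h _; exact: TensTrans.
- by move=> s s' t t' _ h _ h'; rewrite !map_cat; exact: TensCat.
- by move=> s t; rewrite !map_cat; exact: TensC.
- by move=> n; rewrite raddf0; exact: Tens0.
- by move=> m m' n; rewrite raddfD; exact: TensDl.
- by move=> m n n'; rewrite raddfD; exact: TensDr.
- by move=> a m n; rewrite fZ gZ; exact: TensZ.
Qed.

Definition tens_map (q : tensor M N) : tensor M' N' :=
  cls (@tens_eq _ M' N') [seq (f p.1, g p.2) | p <- repr q].

Lemma tens_mapE s : tens_map (cls (@tens_eq _ M N) s) =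
  cls (@tens_eq _ M' N') [seq (f p.1, g p.2) | p <- s].
Proof.
apply/(cls_eq (tens_eq_equiv M' N')); apply: tens_eq_map.
exact: repr_cls (tens_eq_equiv M N) s.
Qed.

End TensorMap.

Section TensorModule.
Variables (R : comPzRingType) (M N : lmodType R).
Local Notation T := (tensor M N).
Local Notation tcls := (cls (@tens_eq R M N)).
Let tcls_eq := cls_eq (tens_eq_equiv M N).

HB.instance Definition _ := gen_eqMixin T.
HB.instance Definition _ := gen_choiceMixin T.

Definition tens (m : M) (n : N) : T := tcls [:: (m, n)].

Definition tens_add (q r : T) : T := tcls (repr q ++ repr r).

Lemma tens_addE s t : tens_add (tcls s) (tcls t) = tcls (s ++ t).
Proof.
by apply/tcls_eq; apply: TensCat; exact: repr_cls (tens_eq_equiv M N) _.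
Qed.

Lemma tensP (q : T) : exists s, q = tcls s.
Proof. by exists (repr q); rewrite reprK. Qed.

Fact tens_addA : associative tens_add.
Proof.
move=> q r u; have [[s ->] [t ->] [v ->]] := And3 (tensP q) (tensP r) (tensP u).
by rewrite !tens_addE catA.
Qed.

Fact tens_addC : commutative tens_add.
Proof.
move=> q r; have [[s ->] [t ->]] := conj (tensP q) (tensP r).
by rewrite !tens_addE; apply/tcls_eq; exact: TensC.
Qed.

Fact tens_add0 : left_id (tcls [::]) tens_add.
Proof. by move=> q; have [s ->] := tensP q; rewrite tens_addE. Qed.

HB.instance Definition _ :=
  GRing.isNmodule.Build T tens_addA tens_addC tens_add0.

Lemma tens_cons m n s : tcls ((m, n) :: s) = tens m n + tcls s.
Proof. exact: esym (tens_addE [:: (m, n)] s). Qed.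

Lemma tensDl m m' n : tens (m + m') n = tens m n + tens m' n.
Proof. by rewrite -tens_cons; apply/tcls_eq; exact: TensDl. Qed.

Lemma tensDr m n n' : tens m (n + n') = tens m n + tens m n'.
Proof. by rewrite -tens_cons; apply/tcls_eq; exact: TensDr. Qed.

Lemma tens_bal a m n : tens (a *: m) n = tens m (a *: n).
Proof. by apply/tcls_eq; exact: TensZ. Qed.

Lemma tens0l n : tens 0 n = 0.
Proof. by apply/tcls_eq; exact: Tens0. Qed.

Let idN : {additive N -> N} := idfun.

Definition tens_opp : T -> T := tens_map (-%R : {additive M -> M}) idN.

Lemma tens_oppE s : tens_opp (tcls s) = tcls [seq (- p.1, p.2) | p <- s].
Proof. by apply: (tens_mapE (sigma := idfun)) => // a m; rewrite /= scalerN. Qed.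

Fact tens_addN : left_inverse 0 tens_opp +%R.
Proof.
move=> q; have [s ->] := tensP q; rewrite tens_oppE.
elim: s => [|[m n] s IH] /=; first by rewrite addr0.
by rewrite !tens_cons addrACA IH addr0 -tensDl addNr tens0l.
Qed.

HB.instance Definition _ := GRing.Nmodule_isZmodule.Build T tens_addN.

Definition tens_scale (a : R) : T -> T :=
  tens_map ( *:%R a : {additive M -> M}) idN.

Lemma tens_scaleE a s : tens_scale a (tcls s) = tcls [seq (a *: p.1, p.2) | p <- s].
Proof.
apply: (tens_mapE (sigma := idfun)) => // b m.
by rewrite /= !scalerA mulrC.
Qed.

Fact tens_scaleA a b q : tens_scale a (tens_scale b q) = tens_scale (a * b) q.
Proof.
have [s ->] := tensP q; rewrite !tens_scaleE -map_comp.
by congr tcls; apply: eq_map => p /=; rewrite scalerA.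
Qed.

Fact tens_scale1 : left_id 1 tens_scale.
Proof.
move=> q; have [s ->] := tensP q; rewrite !tens_scaleE.
by congr tcls; rewrite -[RHS]map_id; apply: eq_map => -[m n] /=; rewrite scale1r.
Qed.

Fact tens_scaleDr : right_distributive tens_scale +%R.
Proof.
move=> a q r; have [[s ->] [t ->]] := conj (tensP q) (tensP r).
have -> : (tcls s : T) + (tcls t : T) = tcls (s ++ t) := tens_addE s t.
rewrite !tens_scaleE map_cat; exact: esym (tens_addE _ _).
Qed.

Fact tens_scaleDl q : {morph tens_scale^~ q : a b / a + b}.
Proof.
move=> a b; have [s ->] := tensP q; rewrite !tens_scaleE.
elim: s => [|[m n] s IH] /=; first by rewrite addr0.
by rewrite !tens_cons IH scalerDl tensDl addrACA.
Qed.

HB.instance Definition _ := GRing.Zmodule_isLmodule.Build R T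
  tens_scaleA tens_scale1 tens_scaleDr tens_scaleDl.

Lemma tensZl a m n : tens (a *: m) n = a *: tens m n.
Proof. by rewrite /GRing.scale/= tens_scaleE. Qed.

Lemma tens_ind (P : T -> Prop) : P 0 ->
  (forall m n q, P q -> P (tens m n + q)) -> forall q, P q.
Proof.
move=> P0 PD q; have [s ->] := tensP q.
by elim: s => [|[m n] s IH] //; rewrite tens_cons; exact: PD.
Qed.

End TensorModule.

Section TensorMapLinear.
Variables (R R' : comPzRingType) (sigma : R -> R').
Variables (M N : lmodType R) (M' N' : lmodType R').
Variables (f : {additive M -> M'}) (g : {additive N -> N'}).
Hypothesis fZ : forall a m, f (a *: m) = sigma a *: f m.
Hypothesis gZ : forall a n, g (a *: n) = sigma a *: g n.

Lemma tens_map_pure m n : tens_map f g (tens m n) = tens (f m) (g n).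
Proof. exact: tens_mapE fZ gZ _. Qed.

Lemma tens_map_is_additive : zmod_morphism (tens_map f g).
Proof.
have mD : {morph tens_map f g : q r / q + r}.
  move=> q r; have [[s ->] [t ->]] := conj (tensP q) (tensP r).
  have -> : (cls (@tens_eq R M N) s : tensor M N) + (cls (@tens_eq R M N) t : tensor M N) = _ := tens_addE s t.
  rewrite !(tens_mapE fZ gZ) map_cat; exact: esym (tens_addE _ _).
move=> q r; apply: (addIr (tens_map f g r)).
by rewrite -mD !subrK.
Qed.

Lemma tens_mapZ a q : tens_map f g (a *: q) = sigma a *: tens_map f g q.
Proof.
have [s ->] := tensP q.
rewrite /GRing.scale /= tens_scaleE !(tens_mapE fZ gZ) tens_scaleE -!map_comp.
by congr cls; apply: eq_map => p /=; rewrite fZ.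
Qed.

End TensorMapLinear.

Section TensorSheaf.
Variables (K : fieldType) (X : topologicalType) (A : algSheaf K X).

Section PreTensor.
Variables (M N : modPresheaf A).

Definition ptens_res (U V : opens X) (h : V `<=` U) :
    tensor (M U) (N U) -> tensor (M V) (N V) :=
  tens_map (mod_res h : {additive M U -> M V}) (mod_res h : {additive N U -> N V}).

HB.instance Definition _ (U V : opens X) (h : V `<=` U) :=
  GRing.isZmodMorphism.Build (tensor (M U) (N U)) (tensor (M V) (N V))
    (ptens_res h)
    (tens_map_is_additive (@mod_resZ _ _ _ M U V h) (@mod_resZ _ _ _ N U V h)).

Fact ptens_resZ (U V : opens X) (h : V `<=` U) (a : A U) (q : tensor (M U) (N U)) :
  ptens_res h (a *: q) = alg_res h a *: ptens_res h q.
Proof. exact: (tens_mapZ (@mod_resZ _ _ _ M U V h) (@mod_resZ _ _ _ N U V h)). Qed.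

Lemma ptens_resE (U V : opens X) (h : V `<=` U) (m : M U) (n : N U) :
  ptens_res h (tens m n) = tens (mod_res h m) (mod_res h n).
Proof. exact: (tens_map_pure (@mod_resZ _ _ _ M U V h) (@mod_resZ _ _ _ N U V h)). Qed.

Fact ptens_presheaf : is_presheaf
  (fun U V h => ptens_res h : tensor (M U) (N U) -> tensor (M V) (N V)).
Proof.
split.
- move=> U h; apply: tens_ind => [|m n q IH]; first by rewrite raddf0.
  by rewrite raddfD /= IH ptens_resE (res_id (modP M)) (res_id (modP N)).
- move=> U V W h k l; apply: tens_ind => [|m n q IH]; first by rewrite !raddf0.
  rewrite !raddfD /= IH !ptens_resE.
  by rewrite (res_comp (modP M) h k l) (res_comp (modP N) h k l).
Qed.

Definition ptens : modPresheaf A :=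
  @ModPresheaf K X A (fun U => tensor (M U) (N U)) (fun U V h => ptens_res h)
    ptens_resZ ptens_presheaf.

Definition tensor_sheaf : modSheaf A := genmod ptens.

Definition stens (U : opens X) (m : M U) (n : N U) : tensor_sheaf U :=
  @eta X (mod_presheaf ptens) U (tens m n).

End PreTensor.

Section OneTensor.
Variables (M N N' : modPresheaf A) (U : opens X) (f : modHomOn U N N').

Definition ptens_map (V : opens X) (h : V `<=` U) :
    ptens M N V -> ptens M N' V :=
  tens_map (idfun : {additive M V -> M V}) (f V h : {additive N V -> N' V}).

Lemma ptens_mapE (V : opens X) (h : V `<=` U) (m : M V) (n : N V) :
  ptens_map h (tens m n) = tens m (f V h n).
Proof. by apply: (tens_map_pure (sigma := idfun)) => // a n'; rewrite /= linearZ. Qed.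

Lemma ptens_map_additive (V : opens X) (h : V `<=` U) :
  zmod_morphism (ptens_map h).
Proof. by apply: (tens_map_is_additive (sigma := idfun)) => // a n'; rewrite /= linearZ. Qed.

HB.instance Definition _ (V : opens X) (h : V `<=` U) :=
  GRing.isZmodMorphism.Build (ptens M N V) (ptens M N' V) (ptens_map h)
    (ptens_map_additive h).

Lemma ptens_map_nat (V W : opens X) (hV : V `<=` U) (hW : W `<=` U)
    (h : W `<=` V) (q : mod_presheaf (ptens M N) V) :
  @pres X (mod_presheaf (ptens M N')) V W h (ptens_map hV q) =
  ptens_map hW (@pres X (mod_presheaf (ptens M N)) V W h q).
Proof.
move: q; apply: tens_ind => [|m n q /= IH]; first by rewrite /= !raddf0.
by rewrite /= !raddfD /= IH ptens_mapE !ptens_resE ptens_mapE (mho_nat f hV hW).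
Qed.

Definition one_tensor : tensor_sheaf M N U -> tensor_sheaf M N' U :=
  gen_map ptens_map_nat.

Lemma one_tensorE (m : M U) (n : N U) :
  one_tensor (stens m n) = stens m (f U (fun _ h => h) n).
Proof.
apply: gen_sec_eq => x Ux; rewrite /one_tensor /stens /=.
by rewrite (stalk_mapE ptens_map_nat Ux (fun _ h => h)) ptens_mapE.
Qed.

End OneTensor.

End TensorSheaf.

Section SheafLemmas.
Variables (X : topologicalType) (F : opens X -> Type).
Variable res : forall U V : opens X, V `<=` U -> F U -> F V.
Hypothesis Fsheaf : is_sheaf res.

Lemma sheaf_local (U : opens X) (Pr : forall V : opens X, V `<=` U -> F V -> Prop) :
  (forall (V W : opens X) (h : V `<=` U) (k : W `<=` V) (l : W `<=` U) t,
    Pr V h t -> Pr W l (res k t)) ->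
  (forall (V : opens X) (h h' : V `<=` U) t t', Pr V h t -> Pr V h' t' -> t = t') ->
  (forall x, U x -> exists (V : opens X) (h : V `<=` U) t, V x /\ Pr V h t) ->
  exists t : F U, forall (V : opens X) (h : V `<=` U) t', Pr V h t' -> res h t = t'.
Proof.
move=> Pres Puniq Ploc.
pose I := {V : opens X & {t : F V | exists h : V `<=` U, Pr V h t}}.
have IU (i : I) : tag i `<=` U by case: i => V [t [h ht]] y; exact: h.
have [||t [tE _]] := sheaf_glue Fsheaf (V := fun i : I => tag i) IU
    (fun i => sval (tagged i)).
- move=> x /Ploc[V [h [t [Vx Vt]]]].
  by exists (Tagged (fun V : opens X => {t | exists h : V `<=` U, Pr V h t})
     (exist _ t (ex_intro _ h Vt))).
- case=> V [s [h hs]] [V' [s' [h' hs']]] W /= hi hj.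
  apply: (Puniq W (subset_trans hi h) (subset_trans hi h)); exact: Pres hs || exact: Pres hs'.
exists t => V h t' Vt'.
have := tE (Tagged (fun V : opens X => {t | exists h : V `<=` U, Pr V h t})
     (exist _ t' (ex_intro _ h Vt'))).
by move=> /= <-; congr res; exact: Prop_irrelevance.
Qed.

Lemma sheaf_sep (U : opens X) (s t : F U) :
  (forall x, U x -> exists (V : opens X) (h : V `<=` U), V x /\ res h s = res h t) ->
  s = t.
Proof.
move=> st.
pose I := {V : opens X | exists h : V `<=` U, res h s = res h t}.
have IU (i : I) : sval i `<=` U by case: i => V [h e] y; exact: h.
have [||u [_ uE]] := sheaf_glue Fsheaf (V := fun i : I => sval i) IU
    (fun i => res (IU i) t).
- by move=> x /st[V [h [Vx e]]]; exists (exist _ V (ex_intro _ h e)).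
- move=> i j W hi hj.
  by rewrite !(res_comp Fsheaf _ _ (subset_trans hi (IU i))).
rewrite -(uE s) ?(uE t)// => -[V [h e]] /=.
set k := IU _; by rewrite (Prop_irrelevance k h).
Qed.

End SheafLemmas.

Section MatrixSheaves.
Variables (K : fieldType) (X : topologicalType) (A : algSheaf K X).

Section Rectangular.
Variables m n : nat.

Definition mx_res (U V : opens X) (h : V `<=` U) (a : 'M[A U]_(m, n)) :
  'M[A V]_(m, n) := map_mx (alg_res h) a.

HB.instance Definition _ (U V : opens X) (h : V `<=` U) :=
  GRing.isZmodMorphism.Build 'M[A U]_(m, n) 'M[A V]_(m, n) (mx_res h)
    (@map_mxB _ _ (alg_res h) m n).

Fact mx_resZ (U V : opens X) (h : V `<=` U) (a : A U) (b : 'M[A U]_(m, n)) :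
  mx_res h (a *: b) = alg_res h a *: mx_res h b.
Proof. exact: map_mxZ. Qed.

Fact mx_sheaf_axiom :
  is_sheaf (fun U V h => mx_res h : 'M[A U]_(m, n) -> 'M[A V]_(m, n)).
Proof.
split; first split.
- move=> U h a; apply/matrixP => i j; rewrite mxE; exact: (res_id (algP A)).
- by move=> U V W h k l a; apply/matrixP => i j; rewrite !mxE; exact: (res_comp (algP A)).
move=> U I V VU s cov comp.
have ex i j : exists! t : A U, forall k, alg_res (VU k) t = s k i j.
  apply: (sheaf_glue (algP A) VU (fun k => s k i j)) => // k l W hk hl.
  by move/matrixP: (comp k l W hk hl) => /(_ i j); rewrite !mxE.
exists (\matrix_(i, j) sval (cid (ex i j))); split.
  move=> k; apply/matrixP => i j; rewrite !mxE.
  by case: (cid _) => t /= [tE _].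
move=> b bE; apply/matrixP => i j; rewrite mxE; case: (cid _) => t /= [_]; apply.
by move=> k; rewrite -bE mxE.
Qed.

(* A^n is the case of one column. *)
Definition mx_sheaf : modSheaf A :=
  @ModSheaf K X A
    (@ModPresheaf K X A (fun U => 'M[A U]_(m, n)) (fun U V h => mx_res h)
      mx_resZ mx_sheaf_axiom)
    mx_sheaf_axiom.

End Rectangular.

Lemma mx_resM m n p (U V : opens X) (h : V `<=` U)
    (a : 'M[A U]_(m, n)) (b : 'M[A U]_(n, p)) :
  mx_res h (a *m b) = mx_res h a *m mx_res h b.
Proof. exact: map_mxM. Qed.

Lemma mx_res1 n (U V : opens X) (h : V `<=` U) :
  mx_res h (1%:M : 'M[A U]_n) = 1%:M.
Proof. exact: map_mx1. Qed.

End MatrixSheaves.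

Section GL.

Record gl (R : comPzRingType) (n : nat) := Gl {
  gl_mx :> 'M[R]_n;
  gl_inv : 'M[R]_n;
  gl_mxV : gl_mx *m gl_inv = 1%:M;
  gl_Vmx : gl_inv *m gl_mx = 1%:M }.

Variables (R : comPzRingType) (n : nat).
Implicit Types g h : gl R n.

Lemma gl_eq g h : gl_mx g = gl_mx h -> g = h.
Proof.
case: g h => [a a' aV Va] [b b' bV Vb] /= eab; subst b.
have eV : a' = b' by rewrite -[a']mulmx1 -bV mulmxA Va mul1mx.
by subst b'; congr Gl; exact: Prop_irrelevance.
Qed.

HB.instance Definition _ := gen_eqMixin (gl R n).
HB.instance Definition _ := gen_choiceMixin (gl R n).

Definition gl_one : gl R n := @Gl R n 1%:M 1%:M (mul1mx _) (mul1mx _).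

Definition gl_invg g : gl R n := Gl (gl_Vmx g) (gl_mxV g).

Fact gl_mul_mxV g h : (g *m h) *m (gl_inv h *m gl_inv g) = 1%:M.
Proof. by rewrite mulmxA -(mulmxA (gl_mx g)) gl_mxV mulmx1 gl_mxV. Qed.

Fact gl_mul_Vmx g h : (gl_inv h *m gl_inv g) *m (g *m h) = 1%:M.
Proof. by rewrite mulmxA -(mulmxA (gl_inv h)) gl_Vmx mulmx1 gl_Vmx. Qed.

Definition gl_mul g h : gl R n := Gl (gl_mul_mxV g h) (gl_mul_Vmx g h).

Fact gl_mulA : associative gl_mul.
Proof. by move=> f g h; apply: gl_eq; rewrite /= mulmxA. Qed.

Fact gl_mul1 : left_id gl_one gl_mul.
Proof. by move=> g; apply: gl_eq; rewrite /= mul1mx. Qed.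

Fact gl_1mul : right_id gl_one gl_mul.
Proof. by move=> g; apply: gl_eq; rewrite /= mulmx1. Qed.

Fact gl_mulV : left_inverse gl_one gl_invg gl_mul.
Proof. by move=> g; apply: gl_eq; rewrite /= gl_Vmx. Qed.

Fact gl_Vmul : right_inverse gl_one gl_invg gl_mul.
Proof. by move=> g; apply: gl_eq; rewrite /= gl_mxV. Qed.

HB.instance Definition _ :=
  isGroup.Build (gl R n) gl_mulA gl_mul1 gl_1mul gl_mulV gl_Vmul.

Lemma gl_mx1 : (1%g : gl R n) = 1%:M :> 'M_n. Proof. by []. Qed.
Lemma gl_mxM g h : (g * h)%g = g *m h :> 'M_n. Proof. by []. Qed.
Lemma gl_mxVE g : (g^-1)%g = gl_inv g :> 'M_n. Proof. by []. Qed.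

End GL.

Section GLSheaf.
Variables (K : fieldType) (X : topologicalType) (A : algSheaf K X) (n : nat).

Fact gl_res_mxV (U V : opens X) (h : V `<=` U) (g : gl (A U) n) :
  mx_res h g *m mx_res h (gl_inv g) = 1%:M.
Proof. by rewrite -mx_resM gl_mxV mx_res1. Qed.

Fact gl_res_Vmx (U V : opens X) (h : V `<=` U) (g : gl (A U) n) :
  mx_res h (gl_inv g) *m mx_res h g = 1%:M.
Proof. by rewrite -mx_resM gl_Vmx mx_res1. Qed.

Definition gl_res (U V : opens X) (h : V `<=` U) (g : gl (A U) n) : gl (A V) n :=
  Gl (gl_res_mxV h g) (gl_res_Vmx h g).

Fact gl_res_mul (U V : opens X) (h : V `<=` U) :
  {morph gl_res h : f g / (f * g)%g}.
Proof. by move=> f g; apply: gl_eq; rewrite /= mx_resM. Qed.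

HB.instance Definition _ (U V : opens X) (h : V `<=` U) :=
  isMultiplicative.Build (gl (A U) n) (gl (A V) n) (gl_res h) (gl_res_mul h).

Fact gl_sheaf_axiom :
  is_sheaf (fun U V h => gl_res h : gl (A U) n -> gl (A V) n).
Proof.
have mxP := mx_sheaf_axiom A n n.
split; first split.
- move=> U h g; apply: gl_eq; exact: (res_id mxP).
- by move=> U V W h k l g; apply: gl_eq; exact: (res_comp mxP).
move=> U I V VU s cov comp.
have [a [aE aU]] : exists! a : 'M[A U]_n, forall i, mx_res (VU i) a = s i.
  by apply: (sheaf_glue mxP VU (fun i => s i : 'M_n)) => // i j W hi hj; have /(congr1 (@gl_mx _ _)) := comp i j W hi hj.
have [b [bE bU]] : exists! b : 'M[A U]_n, forall i, mx_res (VU i) b = gl_inv (s i).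
  by apply: (sheaf_glue mxP VU (fun i => gl_inv (s i))) => // i j W hi hj; have /(congr1 (@gl_inv _ _)) := comp i j W hi hj.
have ab : a *m b = 1%:M.
  apply: (sheaf_sep mxP) => x /cov[i Vx]; exists (V i), (VU i); split => //.
  by rewrite mx_resM aE bE gl_mxV mx_res1.
have ba : b *m a = 1%:M.
  apply: (sheaf_sep mxP) => x /cov[i Vx]; exists (V i), (VU i); split => //.
  by rewrite mx_resM aE bE gl_Vmx mx_res1.
exists (Gl ab ba); split; first by move=> i; apply: gl_eq; exact: aE.
move=> g gE; apply: gl_eq; apply: aU => i.
by have /(congr1 (@gl_mx _ _)) := gE i.
Qed.

Definition gl_sheaf : groupSheaf X :=
  @GroupSheaf X (fun U => gl (A U) n) (fun U V h => gl_res h) gl_sheaf_axiom.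

End GLSheaf.
Arguments one_tensor {K X A} M {N N' U} f.

Record diffTriad (K : fieldType) (X : topologicalType) := DiffTriad {
  dt_alg :> algSheaf K X;
  dt_form : modSheaf dt_alg;
  dt_d : forall U, dt_alg U -> dt_form U;
  dt_d_res : forall (U V : opens X) (h : V `<=` U) (s : dt_alg U),
    mod_res h (dt_d s) = dt_d (alg_res h s);
  dt_dD : forall U (s t : dt_alg U), dt_d (s + t) = dt_d s + dt_d t;
  dt_dZ : forall U (k : K) (s : dt_alg U),
    dt_d (alg_in dt_alg U k * s) = alg_in dt_alg U k *: dt_d s;
  dt_leibniz : forall U (s t : dt_alg U), dt_d (s * t) = s *: dt_d t + t *: dt_d s }.

Record groupHom (X : topologicalType) (G H : groupSheaf X) := GroupHom {
  gh_fun :> forall U, {multiplicative G U -> H U};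
  gh_nat : forall (U V : opens X) (h : V `<=` U) (g : G U),
    gs_res h (gh_fun U g) = gh_fun V (gs_res h g) }.

Section Lie.
Variables (K : fieldType) (X : topologicalType) (A : algSheaf K X).

Record lieSheaf := LieSheaf {
  lie_mod :> modSheaf A;
  lie_br : forall U, lie_mod U -> lie_mod U -> lie_mod U;
  lie_br_res : forall (U V : opens X) (h : V `<=` U) (u v : lie_mod U),
    mod_res h (lie_br u v) = lie_br (mod_res h u) (mod_res h v);
  lie_brDZl : forall U (a : A U) (u v w : lie_mod U),
    lie_br (a *: u + v) w = a *: lie_br u w + lie_br v w;
  lie_brDZr : forall U (a : A U) (u v w : lie_mod U),
    lie_br u (a *: v + w) = a *: lie_br u v + lie_br u w;
  lie_br_alt : forall U (u : lie_mod U), lie_br u u = 0;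
  lie_jacobi : forall U (u v w : lie_mod U),
    lie_br u (lie_br v w) + lie_br v (lie_br w u) + lie_br w (lie_br u v) = 0 }.

Record lieHom (L L' : lieSheaf) := LieHom {
  lh_hom :> modHom L L';
  lh_br : forall U (u v : L U),
    lh_hom U (lie_br u v) = lie_br (lh_hom U u) (lh_hom U v) }.

(* [lieAut L U] is Aut(L)(U): the automorphisms of the sheaf L|_U over U, not
   only those of the Lie algebra L(U). *)
Record lieAut (L : lieSheaf) (U : opens X) := LieAut {
  la_hom :> modHomOn U L L;
  la_br : forall (V : opens X) (h : V `<=` U) (u v : L V),
    la_hom V h (lie_br u v) = lie_br (la_hom V h u) (la_hom V h v);
  la_bij : forall (V : opens X) (h : V `<=` U), bijective (la_hom V h) }.

(* A morphism of sheaves of groups G -> Aut(L): the group law of Aut(L)(U) is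
   composition, and restricting to V forgets the components over the open sets
   not contained in V. *)
Record lieRep (G : groupSheaf X) (L : lieSheaf) := LieRep {
  lr_fun :> forall U, G U -> lieAut L U;
  lr_mul : forall U (g g' : G U) (V : opens X) (h : V `<=` U) (u : L V),
    lr_fun (g * g')%g V h u = lr_fun g V h (lr_fun g' V h u);
  lr_res : forall (U V W : opens X) (h : V `<=` U) (k : W `<=` V) (l : W `<=` U)
    (g : G U) (u : L W), lr_fun (gs_res h g) W k u = lr_fun g W l u }.

Section Matrices.
Variable n : nat.
Local Notation Mn := (mx_sheaf A n n).

Definition mx_br (U : opens X) (a b : Mn U) : Mn U :=
  (a : 'M[A U]_n) *m b - (b : 'M[A U]_n) *m a.

Fact mx_br_res (U V : opens X) (h : V `<=` U) (a b : Mn U) :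
  mod_res h (mx_br a b) = mx_br (mod_res h a) (mod_res h b).
Proof. by rewrite /mx_br raddfB /= !mx_resM. Qed.

Fact mx_brDZl (U : opens X) (k : A U) (a b c : Mn U) :
  mx_br (k *: a + b) c = k *: mx_br a c + mx_br b c.
Proof.
rewrite /mx_br mulmxDl mulmxDr -scalemxAl -scalemxAr scalerBr opprD.
by rewrite addrACA.
Qed.

Fact mx_brDZr (U : opens X) (k : A U) (a b c : Mn U) :
  mx_br a (k *: b + c) = k *: mx_br a b + mx_br a c.
Proof.
rewrite /mx_br mulmxDl mulmxDr -scalemxAl -scalemxAr scalerBr opprD.
by rewrite addrACA.
Qed.

Fact mx_br_alt (U : opens X) (a : Mn U) : mx_br a a = 0.
Proof. exact: subrr. Qed.

Fact mx_jacobi (U : opens X) (a b c : Mn U) :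
  mx_br a (mx_br b c) + mx_br b (mx_br c a) + mx_br c (mx_br a b) = 0.
Proof.
rewrite /mx_br !mulmxBr !mulmxBl !mulmxA !opprB.
have tele (Z : zmodType) (x1 x2 x3 x4 x5 x6 : Z) :
    x1 - x2 + (x4 - x3) + (x3 - x5 + (x2 - x6)) + (x6 - x4 + (x5 - x1)) = 0.
  by rewrite [LHS](AC (2*2*2) (1*4*5*2*3*6)) /= !addrA !subrK subrr.
exact: tele.
Qed.

Definition mx_lie : lieSheaf :=
  LieSheaf mx_br_res mx_brDZl mx_brDZr mx_br_alt mx_jacobi.

Section Ad.
Variables (U : opens X) (g : gl (A U) n).

Definition Ad_fun (V : opens X) (h : V `<=` U) (a : Mn V) : Mn V :=
  mx_res h g *m a *m mx_res h (g^-1)%g.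

Fact Ad_is_linear (V : opens X) (h : V `<=` U) : linear (Ad_fun h).
Proof.
by move=> k a b; rewrite /Ad_fun mulmxDr mulmxDl -scalemxAr -scalemxAl.
Qed.

HB.instance Definition _ (V : opens X) (h : V `<=` U) :=
  GRing.isLinear.Build (A V) (Mn V) (Mn V) _ (Ad_fun h) (Ad_is_linear h).

Fact Ad_nat (V W : opens X) (hV : V `<=` U) (hW : W `<=` U) (h : W `<=` V)
  (a : Mn V) : mod_res h (Ad_fun hV a) = Ad_fun hW (mod_res h a).
Proof.
rewrite /Ad_fun /= !mx_resM.
by rewrite !(res_comp (mx_sheaf_axiom A n n) hV h hW).
Qed.

Definition Ad_hom : modHomOn U Mn Mn :=
  @ModHomOn K X A U Mn Mn (fun V h => Ad_fun h) Ad_nat.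

Let resVg (V : opens X) (h : V `<=` U) :
  mx_res h (g^-1)%g *m mx_res h g = 1%:M := gl_res_Vmx h g.
Let resgV (V : opens X) (h : V `<=` U) :
  mx_res h g *m mx_res h (g^-1)%g = 1%:M := gl_res_mxV h g.

Fact Ad_br (V : opens X) (h : V `<=` U) (a b : Mn V) :
  Ad_hom V h (mx_br a b) = mx_br (Ad_hom V h a) (Ad_hom V h b).
Proof.
rewrite [LHS]raddfB /= /mx_br /Ad_fun; congr (_ - _); rewrite !mulmxA.
  by rewrite -(mulmxA _ (mx_res h _) (mx_res h g)) resVg mulmx1.
by rewrite -(mulmxA _ (mx_res h _) (mx_res h g)) resVg mulmx1.
Qed.

Fact Ad_bij (V : opens X) (h : V `<=` U) : bijective (Ad_hom V h).
Proof.
exists (fun a : Mn V => mx_res h (g^-1)%g *m (a : 'M_n) *m mx_res h g) => a /=.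
  by rewrite /Ad_fun !mulmxA resVg mul1mx -mulmxA resVg mulmx1.
rewrite -/(gl_mx (g^-1)%g) /Ad_fun !mulmxA resgV mul1mx -mulmxA.
by rewrite resgV mulmx1.
Qed.

Definition Ad : lieAut mx_lie U := @LieAut mx_lie U Ad_hom Ad_br Ad_bij.

End Ad.

End Matrices.

End Lie.

Section LieType.
Variables (K : fieldType) (X : topologicalType) (T : diffTriad K X).
Local Notation Omega := (dt_form T).

Record lieTypeGroup := LieTypeGroup {
  lt_grp :> groupSheaf X;
  lt_lie : lieSheaf T;
  lt_rho : lieRep lt_grp lt_lie;
  lt_del : forall U, lt_grp U -> tensor_sheaf Omega lt_lie U;
  lt_del_res : forall (U V : opens X) (h : V `<=` U) (g : lt_grp U),
    mod_res h (lt_del g) = lt_del (gs_res h g);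
  lt_delM : forall U (s t : lt_grp U),
    lt_del (s * t)%g = one_tensor Omega (lt_rho U (t^-1)%g) (lt_del s) + lt_del t }.

(* The canonical isomorphism M_n(Omega(U)) -> (Omega (x) M_n(A))(U); it is the
   inverse of theta (x) a |-> (a_ij theta). *)
Definition mx_form n (U : opens X) (theta : 'M[Omega U]_n) :
    tensor_sheaf Omega (mx_sheaf T n n) U :=
  \sum_i \sum_j
    stens (theta i j : Omega U) (delta_mx i j : mx_sheaf T n n U).

(* a^-1 . (d a_ij) *)
Definition gl_del n (U : opens X) (a : gl (T U) n) :
    tensor_sheaf Omega (mx_sheaf T n n) U :=
  mx_form (\matrix_(i, j) \sum_k (a^-1)%g i k *: dt_d (a k j)).

Record lieTypeRep (G : lieTypeGroup) (n : nat) := LieTypeRep {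
  ltr_hom :> groupHom G (gl_sheaf T n);
  ltr_bar : lieHom (lt_lie G) (mx_lie T n);
  ltr_del : forall U (g : G U),
    gl_del (ltr_hom U g) = one_tensor Omega (modHom_on U ltr_bar) (lt_del g);
  ltr_Ad : forall U (g : G U) (V : opens X) (h : V `<=` U) (u : lt_lie G V),
    ltr_bar V (lt_rho G U g V h u) = Ad (ltr_hom U g) V h (ltr_bar V u) }.

End LieType.

(* The action of the fibre product P x_X G is given on sections by an action of
   G(U) on P(U); the open covering and the trivializations P|_Ua -> G|_Ua, with
   their inverses, are part of the data. *)
Record principalSheaf (X : topologicalType) (G : groupSheaf X) := PrincipalSheaf {
  ps_sheaf :> setSheaf X;
  ps_act : forall U, ps_sheaf U -> G U -> ps_sheaf U;
  ps_act_res : forall (U V : opens X) (h : V `<=` U) (s : ps_sheaf U) (g : G U),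
    sh_res h (ps_act s g) = ps_act (sh_res h s) (gs_res h g);
  ps_act1 : forall U (s : ps_sheaf U), ps_act s 1%g = s;
  ps_actM : forall U (s : ps_sheaf U) (g g' : G U),
    ps_act (ps_act s g) g' = ps_act s (g * g')%g;
  ps_idx : Type;
  ps_cov : ps_idx -> opens X;
  ps_covP : forall x, exists alpha, ps_cov alpha x;
  ps_triv : forall alpha (V : opens X), V `<=` ps_cov alpha -> ps_sheaf V -> G V;
  ps_trivV : forall alpha (V : opens X), V `<=` ps_cov alpha -> G V -> ps_sheaf V;
  ps_trivK : forall alpha (V : opens X) (h : V `<=` ps_cov alpha),
    cancel (ps_triv h) (ps_trivV h);
  ps_trivVK : forall alpha (V : opens X) (h : V `<=` ps_cov alpha),
    cancel (ps_trivV h) (ps_triv h);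
  ps_triv_res : forall alpha (V W : opens X) (hV : V `<=` ps_cov alpha)
    (hW : W `<=` ps_cov alpha) (h : W `<=` V) (s : ps_sheaf V),
    gs_res h (ps_triv hV s) = ps_triv hW (sh_res h s);
  ps_triv_act : forall alpha (V : opens X) (h : V `<=` ps_cov alpha)
    (s : ps_sheaf V) (g : G V), ps_triv h (ps_act s g) = (ps_triv h s * g)%g }.

(* s_alpha, the inverse image of the unit section *)
Definition nat_sec (X : topologicalType) (G : groupSheaf X) (P : principalSheaf G)
    (alpha : ps_idx P) : P (ps_cov alpha) :=
  ps_trivV (fun _ h => h) 1%g.

Section GroupMorphisms.
Variables (G H : groupType) (f : {multiplicative G -> H}).

Lemma mult_morph1 : f 1%g = 1%g.
Proof. by apply: (mulgI (f 1%g)); rewrite -gmulfM !mulg1. Qed.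

Lemma mult_morphV g : f (g^-1)%g = (f g)^-1%g.
Proof. by apply: (mulgI (f g)); rewrite -gmulfM !mulgV mult_morph1. Qed.

End GroupMorphisms.

Section PrincipalLemmas.
Variables (X : topologicalType) (G : groupSheaf X) (P : principalSheaf G).

Lemma ps_act_free U (s : P U) (g g' : G U) : ps_act s g = ps_act s g' -> g = g'.
Proof.
move=> e; apply: (sheaf_sep (@gsP _ G)) => x Ux.
have [alpha ax] := ps_covP P x.
exists (openI U (ps_cov alpha)), openIl; split => //.
have := congr1 (fun t => ps_triv (openIr : _ `<=` ps_cov alpha) (sh_res openIl t)) e.
by rewrite /= !ps_act_res !ps_triv_act => /mulgI.
Qed.

Lemma ps_act_trans (alpha : ps_idx P) (V : opens X) (h : V `<=` ps_cov alpha) (s t : P V) :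
  exists g : G V, t = ps_act s g.
Proof.
exists ((ps_triv h s)^-1 * ps_triv h t)%g.
by apply: (can_inj (ps_trivK h)); rewrite ps_triv_act mulVKg.
Qed.

End PrincipalLemmas.

Section AssociatedSheaf.
Variables (K : fieldType) (X : topologicalType) (A : algSheaf K X).
Variables (G : groupSheaf X) (P : principalSheaf G) (n : nat).
Variable phi : groupHom G (gl_sheaf A n).

Local Notation An := (mx_sheaf A n 1).

Definition phi_mx (U : opens X) (g : G U) : 'M[A U]_n := phi U g : gl (A U) n.

Lemma phi_mxM (U : opens X) (g h : G U) :
  phi_mx (g * h)%g = phi_mx g *m phi_mx h.
Proof. by rewrite /phi_mx gmulfM. Qed.

Lemma phi_mx1 (U : opens X) : phi_mx (1%g : G U) = 1%:M.
Proof. by rewrite /phi_mx mult_morph1. Qed.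

Lemma phi_mx_res (U V : opens X) (h : V `<=` U) (g : G U) :
  mx_res h (phi_mx g) = phi_mx (gs_res h g).
Proof. by rewrite /phi_mx -gh_nat. Qed.

Definition assoc_rel (U : opens X) (p q : P U * 'cV[A U]_n) : Prop :=
  exists! g : G U, q.1 = ps_act p.1 g /\ q.2 = phi_mx (g^-1)%g *m p.2.

Lemma assoc_relI U (p q : P U * 'cV[A U]_n) (g : G U) :
  q.1 = ps_act p.1 g -> q.2 = phi_mx (g^-1)%g *m p.2 -> assoc_rel p q.
Proof.
move=> e1 e2; exists g; split=> // g' [e1' _].
by apply: (@ps_act_free _ _ P U p.1); rewrite -e1.
Qed.

Lemma assoc_rel_equiv U : Equivalence (@assoc_rel U).
Proof.
split.
- by move=> p; apply: (@assoc_relI _ _ _ 1%g); rewrite ?ps_act1 ?invg1 ?phi_mx1 ?mul1mx.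
- move=> p q [g [[e1 e2] _]]; apply: (@assoc_relI _ _ _ (g^-1)%g).
    by rewrite e1 ps_actM mulgV ps_act1.
  by rewrite e2 mulmxA -phi_mxM invgK mulgV phi_mx1 mul1mx.
- move=> p q r [g [[e1 e2] _]] [h [[f1 f2] _]]; apply: (@assoc_relI _ _ _ (g * h)%g).
    by rewrite f1 e1 ps_actM.
  by rewrite f2 e2 mulmxA -phi_mxM invgM.
Qed.

Definition assoc_quot (U : opens X) := quot (@assoc_rel U).

Definition assoc_cls (U : opens X) (s : P U) (a : 'cV[A U]_n) : assoc_quot U :=
  cls (@assoc_rel U) (s, a).

Definition assoc_pres (U V : opens X) (h : V `<=` U) (q : assoc_quot U) :
    assoc_quot V :=
  assoc_cls (sh_res h (repr q).1) (mx_res h (repr q).2).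

Lemma assoc_presE (U V : opens X) (h : V `<=` U) (s : P U) (a : 'cV[A U]_n) :
  assoc_pres h (assoc_cls s a) = assoc_cls (sh_res h s) (mx_res h a).
Proof.
apply/(cls_eq (assoc_rel_equiv V)).
have [g [[e1 e2] _]] := repr_cls (assoc_rel_equiv U) (s, a).
move: e1 e2; rewrite -/(assoc_cls s a); case: (repr _) => p b /= -> ->.
apply: (assoc_relI (g := gs_res h g)) => /=; first by rewrite ps_act_res.
by rewrite mx_resM phi_mx_res mult_morphV.
Qed.

Fact assoc_presP : is_presheaf assoc_pres.
Proof.
have qP U (q : assoc_quot U) : exists s a, q = assoc_cls s a.
  by exists (repr q).1, (repr q).2; rewrite /assoc_cls -surjective_pairing reprK.
split.
- move=> U h q; have [s [a ->]] := qP U q.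
  by rewrite assoc_presE (res_id (shP P)) (res_id (mx_sheaf_axiom A n 1)).
- move=> U V W h k l q; have [s [a ->]] := qP U q.
  rewrite !assoc_presE (res_comp (shP P) h k l).
  by rewrite (res_comp (mx_sheaf_axiom A n 1) h k l).
Qed.

Definition assoc_presheaf : presheaf X := Presheaf assoc_presP.

Definition assoc_sec (U : opens X) := gen_sec assoc_presheaf U.

Definition assoc_res (U V : opens X) (h : V `<=` U) :
  assoc_sec U -> assoc_sec V := @gen_res X assoc_presheaf U V h.

Fact assoc_sheaf_axiom : is_sheaf assoc_res.
Proof. exact: gen_sheaf_axiom. Qed.

Definition assoc_psi (alpha : ps_idx P) (V : opens X) (h : V `<=` ps_cov alpha)
    (f : 'cV[A V]_n) : assoc_sec V :=
  @eta X assoc_presheaf V (assoc_cls (sh_res h (nat_sec alpha)) f).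

Lemma assoc_psi_res (alpha : ps_idx P) (V W : opens X) (hV : V `<=` ps_cov alpha)
    (hW : W `<=` ps_cov alpha) (h : W `<=` V) (f : 'cV[A V]_n) :
  assoc_res h (assoc_psi hV f) = assoc_psi hW (mx_res h f).
Proof.
rewrite /assoc_res /assoc_psi eta_res /= assoc_presE.
by rewrite (res_comp (shP P) hV h hW).
Qed.

Lemma assoc_psi_inj (alpha : ps_idx P) (V : opens X) (h : V `<=` ps_cov alpha) :
  injective (assoc_psi h).
Proof.
move=> f f' /eta_eq e; apply: (sheaf_sep (mx_sheaf_axiom A n 1)) => x Vx.
have [W [k [Wx {}e]]] := e x Vx; exists W, k; split => //.
move: e; rewrite /= !assoc_presE => /(cls_eq (assoc_rel_equiv W))[g [/= [e1 e2] _]].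
rewrite e2; suff -> : g = 1%g by rewrite invg1 phi_mx1 mul1mx.
by apply: (ps_act_free (s := sh_res k (sh_res h (nat_sec alpha)))); rewrite -e1 ps_act1.
Qed.

Lemma assoc_psi_surj (alpha : ps_idx P) (V : opens X) (h : V `<=` ps_cov alpha) (s : assoc_sec V) :
  exists f, assoc_psi h f = s.
Proof.
pose Pr (W : opens X) (k : W `<=` V) (f : An W) :=
  exists l : W `<=` ps_cov alpha, assoc_psi l f = assoc_res k s.
have [W W' k m l f [j e]|W k k' f f' [l e] [l' e']|x Vx|f fE] :=
  sheaf_local (mx_sheaf_axiom A n 1) (Pr := Pr).
- exists (subset_trans m j); rewrite -(assoc_psi_res j _ m) e.
  exact: (res_comp assoc_sheaf_axiom).
- apply: (@assoc_psi_inj _ _ l); rewrite e (Prop_irrelevance l l') e'.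
  by rewrite (Prop_irrelevance k k').
- have [W [k [q [Wx e]]]] := eta_loc_surj s Vx.
  have l := subset_trans k h.
  rewrite -(reprK q) in e; move: (repr q) e => [p b] e.
  have [g pE] := ps_act_trans l (sh_res l (nat_sec alpha)) p.
  exists W, k, (phi_mx g *m b); split => //; exists l.
  rewrite [RHS]e; congr eta; apply/(cls_eq (assoc_rel_equiv W)).
  by apply: (assoc_relI (g := g)) => //=; rewrite mulmxA -phi_mxM mulVg phi_mx1 mul1mx.
exists f; apply: (sheaf_sep assoc_sheaf_axiom) => x Vx.
have [W [k [q [Wx e]]]] := eta_loc_surj s Vx.
have l := subset_trans k h.
rewrite -(reprK q) in e; move: (repr q) e => [p b] e.
have [g pE] := ps_act_trans l (sh_res l (nat_sec alpha)) p.
exists W, k; split => //; rewrite (assoc_psi_res _ l k).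
have := fE W k (phi_mx g *m b) => ->.
  rewrite [RHS]e; congr eta; apply/(cls_eq (assoc_rel_equiv W)).
  by apply: (assoc_relI (g := g)) => //=; rewrite mulmxA -phi_mxM mulVg phi_mx1 mul1mx.
exists l; rewrite [RHS]e; congr eta; apply/(cls_eq (assoc_rel_equiv W)).
by apply: (assoc_relI (g := g)) => //=; rewrite mulmxA -phi_mxM mulVg phi_mx1 mul1mx.
Qed.

Definition assoc_coord (alpha : ps_idx P) (V : opens X) (h : V `<=` ps_cov alpha)
  (s : assoc_sec V) : 'cV[A V]_n := sval (cid (assoc_psi_surj h s)).

Lemma assoc_coordK (alpha : ps_idx P) (V : opens X) (h : V `<=` ps_cov alpha) :
  cancel (assoc_coord h) (assoc_psi h).
Proof. by move=> s; exact: svalP (cid (assoc_psi_surj h s)). Qed.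

Lemma assoc_psiK (alpha : ps_idx P) (V : opens X) (h : V `<=` ps_cov alpha) :
  cancel (assoc_psi h) (assoc_coord h).
Proof. by move=> f; apply: (@assoc_psi_inj _ _ h); rewrite assoc_coordK. Qed.

Lemma assoc_coord_res (alpha : ps_idx P) (V W : opens X) (hV : V `<=` ps_cov alpha)
    (hW : W `<=` ps_cov alpha) (h : W `<=` V) (s : assoc_sec V) :
  assoc_coord hW (assoc_res h s) = mx_res h (assoc_coord hV s).
Proof.
by apply: (@assoc_psi_inj _ _ hW); rewrite assoc_coordK -(assoc_psi_res hV) assoc_coordK.
Qed.

Lemma assoc_trans (alpha beta : ps_idx P) (V : opens X) (ha : V `<=` ps_cov alpha)
    (hb : V `<=` ps_cov beta) :
  exists T : 'M[A V]_n, forall s, assoc_coord ha s = T *m assoc_coord hb s.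
Proof.
have [g gE] := ps_act_trans ha (sh_res ha (nat_sec alpha)) (sh_res hb (nat_sec beta)).
exists (phi_mx g) => s; apply: (@assoc_psi_inj _ _ ha); rewrite assoc_coordK.
rewrite -[LHS](assoc_coordK hb); congr eta; apply/esym.
apply/(cls_eq (assoc_rel_equiv V)); apply: (assoc_relI (g := g)) => //=.
by rewrite mulmxA -phi_mxM mulVg phi_mx1 mul1mx.
Qed.

Lemma assoc_ext U (s t : assoc_sec U) :
  (forall (alpha : ps_idx P) (V : opens X) (h : V `<=` U) (ha : V `<=` ps_cov alpha),
    assoc_coord ha (assoc_res h s) = assoc_coord ha (assoc_res h t)) -> s = t.
Proof.
move=> e; apply: (sheaf_sep assoc_sheaf_axiom) => x Ux.
have [alpha ax] := ps_covP P x.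
exists (openI U (ps_cov alpha)), openIl; split => //.
by rewrite -[LHS](assoc_coordK openIr) e assoc_coordK.
Qed.

(* The A-module structure of the associated sheaf is the one for which all the
   [assoc_psi] are linear (see [assoc_psi_is_linear]): the operations are
   glued from those on the local coordinates [assoc_coord]. *)
Section Ops.
Variable U : opens X.

Lemma assoc_glue (w : forall (alpha : ps_idx P) (V : opens X),
    V `<=` U -> V `<=` ps_cov alpha -> 'cV[A V]_n) :
  (forall (alpha : ps_idx P) (V W : opens X) (h : V `<=` U) (ha : V `<=` ps_cov alpha)
    (k : W `<=` V) (l : W `<=` U) (la : W `<=` ps_cov alpha),
    mx_res k (w alpha V h ha) = w alpha W l la) ->
  (forall (alpha beta : ps_idx P) (V : opens X) (h : V `<=` U) (ha : V `<=` ps_cov alpha)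
    (hb : V `<=` ps_cov beta) (T : 'M[A V]_n),
    (forall s, assoc_coord ha s = T *m assoc_coord hb s) ->
    w alpha V h ha = T *m w beta V h hb) ->
  exists r : assoc_sec U, forall (alpha : ps_idx P) (V : opens X) (h : V `<=` U)
    (ha : V `<=` ps_cov alpha), assoc_coord ha (assoc_res h r) = w alpha V h ha.
Proof.
move=> wres wtrans.
pose Pr (V : opens X) (h : V `<=` U) (r : assoc_sec V) :=
  exists (alpha : ps_idx P) (ha : V `<=` ps_cov alpha), assoc_coord ha r = w alpha V h ha.
have [V W h k l r [alpha [ha e]]|V h h' r r' [alpha [ha e]] [beta [hb e']]|x Ux|r rE] :=
  sheaf_local assoc_sheaf_axiom (Pr := Pr).
- have la := subset_trans k ha.
  by exists alpha, la; rewrite (assoc_coord_res ha) e (wres _ _ _ h ha k l la).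
- have [T TE] := assoc_trans ha hb.
  rewrite -[r](assoc_coordK ha) e (wtrans _ _ _ _ _ hb T TE).
  by rewrite (Prop_irrelevance h h') -e' -TE assoc_coordK.
- have [alpha ax] := ps_covP P x.
  exists (openI U (ps_cov alpha)), openIl.
  exists (assoc_psi openIr (w alpha _ openIl openIr)); split => //.
  by exists alpha, openIr; rewrite assoc_psiK.
exists r => alpha V h ha.
rewrite (rE V h (assoc_psi ha (w alpha V h ha))) ?assoc_psiK//.
by exists alpha, ha; rewrite assoc_psiK.
Qed.

Definition is_assoc_add (s t r : assoc_sec U) : Prop :=
  forall (alpha : ps_idx P) (V : opens X) (h : V `<=` U) (ha : V `<=` ps_cov alpha),
    assoc_coord ha (assoc_res h r) =
    assoc_coord ha (assoc_res h s) + assoc_coord ha (assoc_res h t).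

Definition is_assoc_zero (r : assoc_sec U) : Prop :=
  forall (alpha : ps_idx P) (V : opens X) (h : V `<=` U) (ha : V `<=` ps_cov alpha),
    assoc_coord ha (assoc_res h r) = 0.

Definition is_assoc_scale (a : A U) (s r : assoc_sec U) : Prop :=
  forall (alpha : ps_idx P) (V : opens X) (h : V `<=` U) (ha : V `<=` ps_cov alpha),
    assoc_coord ha (assoc_res h r) =
    alg_res h a *: assoc_coord ha (assoc_res h s).

Let mres_coord (alpha : ps_idx P) (V W : opens X) (h : V `<=` U) (ha : V `<=` ps_cov alpha)
    (k : W `<=` V) (l : W `<=` U) (la : W `<=` ps_cov alpha) (s : assoc_sec U) :
  mx_res k (assoc_coord ha (assoc_res h s)) = assoc_coord la (assoc_res l s).
Proof.
by rewrite -(assoc_coord_res ha la) (res_comp assoc_sheaf_axiom h k l).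
Qed.

Fact assoc_add_ex s t : exists r, is_assoc_add s t r.
Proof.
apply: (assoc_glue (w := fun alpha V h ha =>
  assoc_coord ha (assoc_res h s) + assoc_coord ha (assoc_res h t))).
- by move=> *; rewrite raddfD /=; congr (_ + _); exact: mres_coord.
- by move=> alpha beta V h ha hb T TE; rewrite mulmxDr -!TE.
Qed.

Fact assoc_zero_ex : exists r, is_assoc_zero r.
Proof.
apply: (assoc_glue (w := fun alpha V h ha => 0)).
- by move=> *; rewrite raddf0.
- by move=> *; rewrite mulmx0.
Qed.

Fact assoc_scale_ex a s : exists r, is_assoc_scale a s r.
Proof.
apply: (assoc_glue (w := fun alpha V h ha =>
  alg_res h a *: assoc_coord ha (assoc_res h s))).
- move=> alpha V W h ha k l la; rewrite mx_resZ (mres_coord h ha k l la).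
  by congr (_ *: _); exact: (res_comp (algP A)).
- by move=> alpha beta V h ha hb T TE; rewrite -scalemxAr -TE.
Qed.

Definition assoc_add s t : assoc_sec U := sval (cid (assoc_add_ex s t)).
Definition assoc_zero : assoc_sec U := sval (cid assoc_zero_ex).
Definition assoc_scale a s : assoc_sec U := sval (cid (assoc_scale_ex a s)).
Definition assoc_opp s : assoc_sec U := assoc_scale (-1) s.

Lemma assoc_addE s t : is_assoc_add s t (assoc_add s t).
Proof. exact: svalP (cid (assoc_add_ex s t)). Qed.
Lemma assoc_zeroE : is_assoc_zero assoc_zero.
Proof. exact: svalP (cid assoc_zero_ex). Qed.
Lemma assoc_scaleE a s : is_assoc_scale a s (assoc_scale a s).
Proof. exact: svalP (cid (assoc_scale_ex a s)). Qed.

HB.instance Definition _ := gen_eqMixin (assoc_sec U).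
HB.instance Definition _ := gen_choiceMixin (assoc_sec U).

Fact assoc_addA : associative assoc_add.
Proof. by move=> s t r; apply: assoc_ext => *; rewrite !assoc_addE addrA. Qed.
Fact assoc_addC : commutative assoc_add.
Proof. by move=> s t; apply: assoc_ext => *; rewrite !assoc_addE addrC. Qed.
Fact assoc_add0 : left_id assoc_zero assoc_add.
Proof. by move=> s; apply: assoc_ext => *; rewrite assoc_addE assoc_zeroE add0r. Qed.
Fact assoc_addN : left_inverse assoc_zero assoc_opp assoc_add.
Proof.
move=> s; apply: assoc_ext => *; rewrite assoc_addE assoc_scaleE assoc_zeroE.
by rewrite rmorphN rmorph1 scaleN1r addNr.
Qed.

HB.instance Definition _ := GRing.isZmodule.Build (assoc_sec U)
  assoc_addA assoc_addC assoc_add0 assoc_addN.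

Fact assoc_scaleA a b s : assoc_scale a (assoc_scale b s) = assoc_scale (a * b) s.
Proof. by apply: assoc_ext => *; rewrite !assoc_scaleE scalerA rmorphM. Qed.
Fact assoc_scale1 : left_id 1 assoc_scale.
Proof. by move=> s; apply: assoc_ext => *; rewrite assoc_scaleE rmorph1 scale1r. Qed.
Fact assoc_scaleDr : right_distributive assoc_scale +%R.
Proof.
move=> a s t; apply: assoc_ext => *.
by rewrite assoc_addE !assoc_scaleE assoc_addE scalerDr.
Qed.
Fact assoc_scaleDl s : {morph assoc_scale^~ s : a b / a + b}.
Proof.
move=> a b; apply: assoc_ext => *.
by rewrite assoc_addE !assoc_scaleE rmorphD scalerDl.
Qed.

HB.instance Definition _ := GRing.Zmodule_isLmodule.Build (A U) (assoc_sec U)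
  assoc_scaleA assoc_scale1 assoc_scaleDr assoc_scaleDl.

End Ops.

Fact assoc_psi_is_linear (alpha : ps_idx P) (V : opens X) (h : V `<=` ps_cov alpha) :
  linear (assoc_psi h).
Proof.
move=> a f g; apply: (can_inj (assoc_coordK h)); rewrite assoc_psiK.
have rid (s : assoc_sec V) : assoc_res (fun _ h => h) s = s.
  exact: (res_id assoc_sheaf_axiom).
have := assoc_addE (a *: assoc_psi h f) (assoc_psi h g) (fun _ h => h) h.
rewrite !rid => ->; have := assoc_scaleE a (assoc_psi h f) (fun _ h => h) h.
rewrite !rid => ->; rewrite !assoc_psiK; congr (_ *: _ + _).
by rewrite (res_id (algP A)).
Qed.

HB.instance Definition _ (alpha : ps_idx P) (V : opens X) (h : V `<=` ps_cov alpha) :=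
  GRing.isLinear.Build (A V) 'cV[A V]_n (assoc_sec V) _ (assoc_psi h)
    (assoc_psi_is_linear h).

Fact assoc_res_additive (U V : opens X) (h : V `<=` U) : zmod_morphism (assoc_res h).
Proof.
have mD : {morph assoc_res h : s t / s + t}.
  move=> s t; apply: assoc_ext => alpha W k ha.
  have l := subset_trans k h.
  rewrite (res_comp assoc_sheaf_axiom h k l) !assoc_addE.
  by rewrite !(res_comp assoc_sheaf_axiom h k l).
move=> s t; apply: (addIr (assoc_res h t)).
by rewrite -mD !subrK.
Qed.

HB.instance Definition _ (U V : opens X) (h : V `<=` U) :=
  GRing.isZmodMorphism.Build (assoc_sec U) (assoc_sec V) (assoc_res h)
    (assoc_res_additive h).

Fact assoc_resZ (U V : opens X) (h : V `<=` U) (a : A U) (s : assoc_sec U) :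
  assoc_res h (a *: s) = alg_res h a *: assoc_res h s.
Proof.
apply: assoc_ext => alpha W k ha; have l := subset_trans k h.
rewrite (res_comp assoc_sheaf_axiom h k l) !assoc_scaleE.
rewrite (res_comp assoc_sheaf_axiom h k l); congr (_ *: _).
by rewrite (res_comp (algP A) h k l).
Qed.

Definition assoc_sheaf : modSheaf A :=
  @ModSheaf K X A
    (@ModPresheaf K X A (fun U => assoc_sec U) (fun U V h => assoc_res h)
      assoc_resZ assoc_sheaf_axiom)
    assoc_sheaf_axiom.

Definition assoc_frame (alpha : ps_idx P) (j : 'I_n) : assoc_sheaf (ps_cov alpha) :=
  assoc_psi (fun _ h => h) (delta_mx j 0).

End AssociatedSheaf.

Section Connections.
Variables (K : fieldType) (X : topologicalType) (T : diffTriad K X).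
Local Notation Omega := (dt_form T).

Record connection (G : lieTypeGroup T) (P : principalSheaf G) := Connection {
  conn_fun :> forall U, P U -> tensor_sheaf Omega (lt_lie G) U;
  conn_res : forall (U V : opens X) (h : V `<=` U) (s : P U),
    mod_res h (conn_fun s) = conn_fun (sh_res h s);
  conn_act : forall U (s : P U) (g : G U),
    conn_fun (ps_act s g) =
    one_tensor Omega (lt_rho G U (g^-1)%g) (conn_fun s) + lt_del g }.

Record linConnection (E : modSheaf T) := LinConnection {
  nabla_fun :> forall U, E U -> tensor_sheaf E Omega U;
  nabla_res : forall (U V : opens X) (h : V `<=` U) (s : E U),
    mod_res h (nabla_fun s) = nabla_fun (mod_res h s);
  nablaD : forall U (s t : E U), nabla_fun (s + t) = nabla_fun s + nabla_fun t;
  nablaZ : forall U (k : K) (s : E U),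
    nabla_fun (alg_in T U k *: s) = alg_in T U k *: nabla_fun s;
  nabla_leibniz : forall U (a : T U) (s : E U),
    nabla_fun (a *: s) = a *: nabla_fun s + stens s (dt_d a) }.

Variables (G : lieTypeGroup T) (P : principalSheaf G) (n : nat).
Variable phi : lieTypeRep G n.
Local Notation E := (assoc_sheaf P phi).

Definition conn_form (D : connection P) (alpha : ps_idx P) :
    tensor_sheaf Omega (lt_lie G) (ps_cov alpha) := D _ (nat_sec alpha).

Definition is_conn_matrix (nabla : linConnection E) (alpha : ps_idx P)
    (theta : 'M[Omega (ps_cov alpha)]_n) : Prop :=
  forall j, nabla _ (assoc_frame phi alpha j) =
    \sum_i stens (assoc_frame phi alpha i) (theta i j).

Definition induces (D : connection P) (nabla : linConnection E) : Prop :=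
  forall alpha, exists2 theta : 'M[Omega (ps_cov alpha)]_n,
    is_conn_matrix nabla theta &
    mx_form theta = one_tensor Omega (modHom_on _ (ltr_bar phi)) (conn_form D alpha).

End Connections.

(* Main.v *)
From HB Require Import structures.
From mathcomp Require Import all_boot all_order all_algebra.
From mathcomp Require Import boolp classical_sets reals topology.
Require Import Defs.

(** Locally, over a section [p] of the principal sheaf, a section of the
    associated sheaf E is a class [[p, f]] with [f] a column of functions, and
    a connection on E has to be given by the classical formula

      nabla [p, f] = sum_j [p, e_j] (x) (d f + theta_p f)_j ,

    where e_j is the standard basis and theta_p is the matrix of 1-forms that
    corresponds to the image of [D p] under 1 (x) phibar.  Everything rests on
    the fact that the right-hand side depends only on the class of (p, f)
    ([cov_der_act]).  Write a = phi(g), so that [[p g, a^-1 f] = [p, f]].  The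
    transformation law of D, together with the two conditions that make phi of
    Lie type, becomes the classical change of gauge

      theta_(p g) = a^-1 (theta_p a + d a)

    ([conn_mx_act]): compatibility with the representations on the Lie algebras
    turns rho(g^-1) into conjugation by a^-1 ([rep_form_rho]), and compatibility
    with the Maurer-Cartan differentials turns the differential of g into
    a^-1 d a ([rep_form_del]).  The terms with d a and d (a^-1) then cancel
    because d (a a^-1) = d 1 = 0.

    The formula therefore defines a map on the presheaf of classes, compatible
    with restrictions, and such a map extends to the generated sheaf
    ([gen_lift]).  Additivity and the Leibniz rule are local, hence may be
    checked over the open sets of the trivializing cover, where every section
    is some [[s_alpha, f]].  On the frame of s_alpha one has d e_j = 0, so that
    the local connection form is theta_(s_alpha).  Uniqueness holds because the
    Leibniz rule determines a connection from its values on the local frames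
    ([linConnection_frame_ext]), and those are prescribed.

    To speak of theta_p as a matrix, the isomorphism of M_n(Omega) with
    Omega (x) M_n(A) has to be inverted; the inverse [form_mx] comes from the
    universal property of the tensor product of sheaves ([tensor_sheaf_lift]).
    Its companion [tensor_sheaf_ext], which reduces equalities of additive maps
    to sections t (x) u, yields all identities between maps out of such tensor
    products. *)

Set Implicit Arguments.
Unset Strict Implicit.
Unset Printing Implicit Defensive.

Import GRing.Theory.
Local Open Scope classical_set_scope.
Local Open Scope ring_scope.

(** * Additive maps *)

Lemma zmod_morphism_of_add (V W : zmodType) (f : V -> W) :
  {morph f : x y / x + y} -> zmod_morphism f.
Proof. by move=> fD x y; apply: (addIr (f y)); rewrite -fD !subrK. Qed.

Lemma morph_add0 (V W : zmodType) (f : V -> W) : {morph f : x y / x + y} -> f 0 = 0.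
Proof. by move=> fD; apply: (addrI (f 0)); rewrite -fD !addr0. Qed.

(** * Maps out of a tensor product *)

Section BilinearLift.
Variables (R : comPzRingType) (M N : lmodType R) (Z : zmodType).
Variable b : M -> N -> Z.
Hypothesis bDl : forall m m' n, b (m + m') n = b m n + b m' n.
Hypothesis bDr : forall m n n', b m (n + n') = b m n + b m n'.
Hypothesis b_bal : forall a m n, b (a *: m) n = b m (a *: n).

(** A balanced biadditive map respects the relations that define the tensor
    product, so that its sum over a formal sum depends only on the class. *)
Lemma tens_eq_sum s t : tens_eq s t ->
  \sum_(p <- s) b p.1 p.2 = \sum_(p <- t) b p.1 p.2.
Proof.
elim=> {s t} [//|s t _ -> //|s t r _ -> _ -> //|s s' t t' _ e _ e'|s t|n|m m' n|m n n'|a m n];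
  rewrite ?big_cat ?big_cons ?big_nil ?addr0 /=.
- by rewrite e e'.
- exact: addrC.
- by apply: (addrI (b 0 n)); rewrite -bDl !addr0.
- exact: bDl.
- exact: bDr.
- exact: b_bal.
Qed.

Definition tens_lift (q : tensor M N) : Z := \sum_(p <- repr q) b p.1 p.2.

Lemma tens_liftE s : tens_lift (cls (@tens_eq R M N) s) = \sum_(p <- s) b p.1 p.2.
Proof. exact/tens_eq_sum/(repr_cls (tens_eq_equiv M N)). Qed.

Lemma tens_lift_pure m n : tens_lift (tens m n) = b m n.
Proof. by rewrite tens_liftE big_seq1. Qed.

Lemma tens_liftD : {morph tens_lift : q r / q + r}.
Proof.
move=> q r; have [[s ->] [t ->]] := conj (tensP q) (tensP r).
have -> : (cls (@tens_eq R M N) s : tensor M N) + (cls (@tens_eq R M N) t : tensor M N)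
  = cls (@tens_eq R M N) (s ++ t) := tens_addE s t.
by rewrite !tens_liftE big_cat.
Qed.

End BilinearLift.

(** * Maps out of a generated sheaf *)

Section SheafificationLift.
Variables (X : topologicalType) (F : presheaf X).
Variables (S : opens X -> Type) (res : forall U V : opens X, V `<=` U -> S U -> S V).
Hypothesis Ssheaf : is_sheaf res.
Variable f : forall V : opens X, F V -> S V.
Hypothesis f_nat : forall (V W : opens X) (h : W `<=` V) (q : F V),
  res h (f q) = f (pres h q).

(** The values of [f] on local representatives of [s] glue: two representatives
    over the same open set are locally equal, and [S] is separated. *)
Fact gen_lift_ex (U : opens X) (s : gen_sec F U) : exists t : S U,
  forall (V : opens X) (h : V `<=` U) (q : F V), gen_res h s = eta q -> res h t = f q.
Proof.
pose Pr (V : opens X) (h : V `<=` U) (t : S V) :=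
  exists2 q : F V, gen_res h s = eta q & t = f q.
have genP := gen_sheaf_axiom F.
have [V W h k l t [q e ->]|V h h' t t' [q e ->] [q' e' ->]|x Ux|t tE] :=
  sheaf_local Ssheaf (Pr := Pr).
- by exists (pres k q) => //; rewrite -eta_res -e (res_comp genP h k l).
- have /eta_eq {}e : eta q = eta q' by rewrite -e -e'; congr gen_res; exact: Prop_irrelevance.
  apply: (sheaf_sep Ssheaf) => x /e[W [k [Wx {}e]]].
  by exists W, k; rewrite !f_nat e.
- have [V [h [q [Vx e]]]] := eta_loc_surj s Ux.
  by exists V, h, (f q); split=> //; exists q.
by exists t => V h q e; apply: tE; exists q.
Qed.

Definition gen_lift (U : opens X) (s : gen_sec F U) : S U := sval (cid (gen_lift_ex s)).

Lemma gen_liftP (U V : opens X) (h : V `<=` U) (s : gen_sec F U) (q : F V) :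
  gen_res h s = eta q -> res h (gen_lift s) = f q.
Proof. exact: svalP (cid (gen_lift_ex s)) V h q. Qed.

Lemma gen_lift_eta (U : opens X) (q : F U) : gen_lift (eta q) = f q.
Proof.
rewrite -[LHS](res_id Ssheaf (fun _ h => h)); apply: gen_liftP.
exact: (res_id (gen_sheaf_axiom F)).
Qed.

Lemma gen_lift_res (U V : opens X) (h : V `<=` U) (s : gen_sec F U) :
  res h (gen_lift s) = gen_lift (gen_res h s).
Proof.
apply: (sheaf_sep Ssheaf) => x Vx.
have [W [k [q [Wx e]]]] := eta_loc_surj (gen_res h s) Vx.
exists W, k; split=> //; rewrite (gen_liftP e).
rewrite (res_comp Ssheaf h k (subset_trans k h)); apply: gen_liftP.
by rewrite -e (res_comp (gen_sheaf_axiom F) h k (subset_trans k h)).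
Qed.

End SheafificationLift.

Section GenMod.
Variables (K : fieldType) (X : topologicalType) (A : algSheaf K X).
Variable M : modPresheaf A.

(** The map [eta] with the structure of module on its source and target. *)
Definition genmod_eta (U : opens X) (m : M U) : genmod M U := @eta X (mod_presheaf M) U m.

Lemma genmod_etaD (U : opens X) : {morph @genmod_eta U : m n / m + n}.
Proof. by move=> m n; apply: gen_sec_eq => x Ux; rewrite /= stalk_addE. Qed.

HB.instance Definition _ (U : opens X) := GRing.isZmodMorphism.Build (M U) (genmod M U)
  (@genmod_eta U) (zmod_morphism_of_add (@genmod_etaD U)).

Lemma genmod_etaZ (U : opens X) (a : A U) (m : M U) : genmod_eta (a *: m) = a *: genmod_eta m.
Proof.
apply: gen_sec_eq => x Ux /=.
by rewrite (stalk_scaleE _ _ (fun _ h => h)) (res_id (algP A)).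
Qed.

Lemma genmod_eta_res (U V : opens X) (h : V `<=` U) (m : M U) :
  mod_res h (genmod_eta m) = genmod_eta (mod_res h m).
Proof. exact: (@eta_res _ (mod_presheaf M)). Qed.

Lemma genmod_eta_loc_surj (U : opens X) (s : genmod M U) x : U x ->
  exists (V : opens X) (h : V `<=` U) (m : M V), V x /\ mod_res h s = genmod_eta m.
Proof. exact: (@eta_loc_surj _ (mod_presheaf M)). Qed.

Lemma genmod_eta_loc_surj2 (U : opens X) (s t : genmod M U) x : U x ->
  exists (V : opens X) (h : V `<=` U) (m n : M V),
    [/\ V x, mod_res h s = genmod_eta m & mod_res h t = genmod_eta n].
Proof.
move=> Ux; have [V [h [m [Vx e]]]] := genmod_eta_loc_surj s Ux.
have [W [k [n [Wx e']]]] := genmod_eta_loc_surj t Ux.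
exists (openI V W), (subset_trans openIl h), (mod_res openIl m), (mod_res openIr n).
rewrite -!genmod_eta_res -e -e'.
by rewrite (res_comp (msP (genmod M)) h openIl (subset_trans openIl h))
  (res_comp (msP (genmod M)) k openIr (subset_trans openIl h)).
Qed.

End GenMod.
Arguments genmod_eta {K X A M U} m.

(** * Tensor products of sheaves of modules *)

Section TensorSheafTheory.
Variables (K : fieldType) (X : topologicalType) (A : algSheaf K X).

Section Pure.
Variables (M N : modPresheaf A) (U : opens X).

Lemma stensDl (m m' : M U) (n : N U) : stens (m + m') n = stens m n + stens m' n.
Proof. by rewrite -[RHS](raddfD genmod_eta) -tensDl. Qed.

Lemma stensDr (m : M U) (n n' : N U) : stens m (n + n') = stens m n + stens m n'.
Proof. by rewrite -[RHS](raddfD genmod_eta) -tensDr. Qed.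

Lemma stens_bal (a : A U) (m : M U) (n : N U) : stens (a *: m) n = stens m (a *: n).
Proof. by rewrite /stens tens_bal. Qed.

Lemma stensZl (a : A U) (m : M U) (n : N U) : stens (a *: m) n = a *: stens m n.
Proof. by rewrite -[RHS]genmod_etaZ -tensZl. Qed.

Lemma stensZr (a : A U) (m : M U) (n : N U) : stens m (a *: n) = a *: stens m n.
Proof. by rewrite -stens_bal stensZl. Qed.

Lemma stens0l (n : N U) : stens (0 : M U) n = 0.
Proof. by apply: (addrI (stens 0 n)); rewrite -stensDl !addr0. Qed.

Lemma stens0r (m : M U) : stens m (0 : N U) = 0.
Proof. by apply: (addrI (stens m 0)); rewrite -stensDr !addr0. Qed.

Lemma stens_suml (I : finType) (m : I -> M U) (n : N U) :
  stens (\sum_i m i) n = \sum_i stens (m i) n.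
Proof.
exact: (big_morph (fun m => stens m n) (fun m m' => stensDl m m' n) (stens0l n)).
Qed.

Lemma stens_sumr (I : finType) (m : M U) (n : I -> N U) :
  stens m (\sum_i n i) = \sum_i stens m (n i).
Proof.
exact: (big_morph (fun n => stens m n) (stensDr m) (stens0r m)).
Qed.

Lemma stens_res (V : opens X) (h : V `<=` U) (m : M U) (n : N U) :
  mod_res h (stens m n) = stens (mod_res h m) (mod_res h n).
Proof.
rewrite -[LHS]/(mod_res h (genmod_eta (tens m n : ptens M N U))) genmod_eta_res.
by rewrite /= ptens_resE.
Qed.

End Pure.

(** The sections t (x) u generate the tensor product of the presheaves, and every
    section of the generated sheaf locally comes from the presheaf; hence the
    need for families of maps that commute with restrictions. *)
Lemma tensor_sheaf_ext (M N : modPresheaf A) (S : modSheaf A) (U : opens X)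
    (f g : forall V : opens X, V `<=` U -> tensor_sheaf M N V -> S V) :
  (forall V h, {morph f V h : w z / w + z}) ->
  (forall V h, {morph g V h : w z / w + z}) ->
  (forall (V W : opens X) (h : V `<=` U) (k : W `<=` V) (l : W `<=` U) w,
    mod_res k (f V h w) = f W l (mod_res k w)) ->
  (forall (V W : opens X) (h : V `<=` U) (k : W `<=` V) (l : W `<=` U) w,
    mod_res k (g V h w) = g W l (mod_res k w)) ->
  (forall V h m n, f V h (stens m n) = g V h (stens m n)) ->
  forall V h w, f V h w = g V h w.
Proof.
move=> fD gD f_res g_res fg V h w; apply: (sheaf_sep (msP S)) => x Vx.
have [W [k [q [Wx e]]]] := genmod_eta_loc_surj w Vx.
exists W, k; split=> //; have l := subset_trans k h.
rewrite (f_res _ _ _ _ l) (g_res _ _ _ _ l) e.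
move: q {e}; apply: tens_ind => [|m n q IH].
  by rewrite raddf0 (morph_add0 (fD W l)) (morph_add0 (gD W l)).
by rewrite raddfD fD gD IH; congr (_ + _); exact: fg.
Qed.

Section Lift.
Variables (M N : modPresheaf A) (S : modSheaf A).
Variable b : forall V : opens X, M V -> N V -> S V.
Hypothesis bDl : forall V (m m' : M V) (n : N V), b (m + m') n = b m n + b m' n.
Hypothesis bDr : forall V (m : M V) (n n' : N V), b m (n + n') = b m n + b m n'.
Hypothesis b_bal : forall V (a : A V) (m : M V) (n : N V), b (a *: m) n = b m (a *: n).
Hypothesis b_res : forall (V W : opens X) (h : W `<=` V) (m : M V) (n : N V),
  mod_res h (b m n) = b (mod_res h m) (mod_res h n).

Let F := mod_presheaf (ptens M N).
Let f (V : opens X) (q : F V) : S V := tens_lift (@b V) q.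

Let f_nat (V W : opens X) (h : W `<=` V) (q : F V) : mod_res h (f q) = f (pres h q).
Proof.
have fD (Z : opens X) : {morph @f Z : q r / (q : tensor _ _) + r >-> q + r}.
  exact: tens_liftD (@bDl Z) (@bDr Z) (@b_bal Z).
have fE (Z : opens X) m n : @f Z (tens m n) = b m n.
  exact: tens_lift_pure (@bDl Z) (@bDr Z) (@b_bal Z) m n.
move: q; apply: tens_ind => [|m n q IH].
  by rewrite [pres h _]raddf0 !(morph_add0 (fD _)) raddf0.
by rewrite fD raddfD /= IH [ptens_res h _]raddfD /= fD ptens_resE !fE b_res.
Qed.

(** The universal property of the tensor product: a balanced biadditive map that
    commutes with restrictions extends to the presheaf of tensor products, and
    from there to the sheaf that it generates. *)
Definition tensor_sheaf_lift (U : opens X) (w : tensor_sheaf M N U) : S U :=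
  gen_lift (msP S) f_nat w.

Lemma tensor_sheaf_liftE (U : opens X) (m : M U) (n : N U) :
  tensor_sheaf_lift (stens m n) = b m n.
Proof.
rewrite /tensor_sheaf_lift gen_lift_eta.
exact: tens_lift_pure (@bDl U) (@bDr U) (@b_bal U) m n.
Qed.

Lemma tensor_sheaf_lift_res (U V : opens X) (h : V `<=` U) (w : tensor_sheaf M N U) :
  mod_res h (tensor_sheaf_lift w) = tensor_sheaf_lift (mod_res h w).
Proof. exact: gen_lift_res. Qed.

Lemma tensor_sheaf_liftD (U : opens X) :
  {morph @tensor_sheaf_lift U : w z / w + z}.
Proof.
move=> w z; apply: (sheaf_sep (msP S)) => x Ux.
have [V [h [q [r [Vx e e']]]]] := genmod_eta_loc_surj2 w z Ux.
exists V, h; split=> //; rewrite raddfD /= !tensor_sheaf_lift_res raddfD /= e e' -raddfD.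
rewrite /tensor_sheaf_lift !gen_lift_eta.
exact: tens_liftD (@bDl V) (@bDr V) (@b_bal V) q r.
Qed.

End Lift.

Section OneTensorTheory.
Variables (M N N' : modPresheaf A).

(** The map [one_tensor] is defined over one open set at a time; restricting the
    morphism of modules gives the family of maps that commutes with
    restrictions ([one_tensor_res]). *)
Definition modHomOn_res (U V : opens X) (k : V `<=` U) (f : modHomOn U N N') :
    modHomOn V N N' :=
  @ModHomOn K X A V N N' (fun W h => f W (subset_trans h k))
    (fun W W' h h' l m => mho_nat f _ _ l m).

Lemma one_tensor_genmod_eta (U : opens X) (f : modHomOn U N N') (q : ptens M N U) :
  one_tensor M f (genmod_eta q) = genmod_eta (ptens_map f (fun _ h => h) q).
Proof.
by apply: gen_sec_eq => x Ux /=; rewrite (stalk_mapE (ptens_map_nat f) Ux (fun _ h => h)).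
Qed.

(** The morphism over the smaller open set need only have the components of [f],
    because restrictions of [lt_rho U g] and [lt_rho V g'] for a restriction [g'] of [g]
    are different terms with the same components. *)
Lemma one_tensor_res (U V : opens X) (f : modHomOn U N N') (f' : modHomOn V N N')
    (k : V `<=` U) (w : tensor_sheaf M N U) :
  (forall (W : opens X) (hU : W `<=` U) (hV : W `<=` V) n, f W hU n = f' W hV n) ->
  mod_res k (one_tensor M f w) = one_tensor M f' (mod_res k w).
Proof.
move=> ff'; apply: gen_sec_eq => x Vx /=.
have [W [h [q [Wx e]]]] := genmod_eta_loc_surj (mod_res k w) Vx.
have /(congr1 (fun s => gsec_fun s Wx)) /= {}e := e.
have -> : gsec_fun w (k x Vx) = germ Wx (q : mod_presheaf _ W).
  by rewrite -e; congr gsec_fun; exact: Prop_irrelevance.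
have l := subset_trans h k.
rewrite (stalk_mapE (ptens_map_nat f) _ l) (stalk_mapE (ptens_map_nat f') _ h).
congr germ; move: q {e}; apply: tens_ind => [|m n q IH].
  by rewrite [LHS]raddf0 [RHS]raddf0.
by rewrite [LHS]raddfD [RHS]raddfD /= IH !ptens_mapE (ff' _ l h).
Qed.

Lemma one_tensorD (U : opens X) (f : modHomOn U N N') :
  {morph one_tensor M f : w z / w + z}.
Proof.
move=> w z; apply: (sheaf_sep (msP (tensor_sheaf M N'))) => x Ux.
have [V [h [q [r [Vx e e']]]]] := genmod_eta_loc_surj2 w z Ux.
exists V, h; split=> //.
have fE W hU hV n : f W hU n = modHomOn_res h f W hV n.
  by congr (mho_fun f _ n); exact: Prop_irrelevance.
rewrite raddfD /= !(one_tensor_res _ _ fE) raddfD /= e e' -raddfD.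
by rewrite !one_tensor_genmod_eta raddfD raddfD.
Qed.

End OneTensorTheory.
End TensorSheafTheory.

(** * Matrices with entries in a module

    Columns and square matrices of 1-forms are multiplied on both sides by
    matrices over the ring; as the entries of the two factors live in different
    structures, the product of matrices over a ring does not apply. *)

Section ModuleMatrices.
Variables (R : comPzRingType) (M : lmodType R).

Definition lmulmx m n p (a : 'M[R]_(m, n)) (w : 'M[M]_(n, p)) : 'M[M]_(m, p) :=
  \matrix_(i, j) \sum_k a i k *: w k j.

Definition rmulmx m n p (w : 'M[M]_(m, n)) (a : 'M[R]_(n, p)) : 'M[M]_(m, p) :=
  \matrix_(i, j) \sum_k a k j *: w i k.

Lemma lmulmxA m n p q (a : 'M_(m, n)) (b : 'M_(n, p)) (w : 'M_(p, q)) :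
  lmulmx a (lmulmx b w) = lmulmx (a *m b) w.
Proof.
apply/matrixP => i j; rewrite !mxE.
under eq_bigr => k _ do rewrite mxE scaler_sumr.
rewrite exchange_big; apply: eq_bigr => k _ /=; rewrite mxE scaler_suml.
by apply: eq_bigr => l _; rewrite scalerA.
Qed.

Lemma rmulmxA m n p q (w : 'M_(m, n)) (a : 'M_(n, p)) (b : 'M_(p, q)) :
  rmulmx (rmulmx w a) b = rmulmx w (a *m b).
Proof.
apply/matrixP => i j; rewrite !mxE.
under eq_bigr => k _ do rewrite mxE scaler_sumr.
rewrite exchange_big; apply: eq_bigr => k _ /=; rewrite mxE scaler_suml.
by apply: eq_bigr => l _; rewrite scalerA mulrC.
Qed.

Lemma lrmulmxA m n p q (a : 'M_(m, n)) (w : 'M_(n, p)) (b : 'M_(p, q)) :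
  rmulmx (lmulmx a w) b = lmulmx a (rmulmx w b).
Proof.
apply/matrixP => i j; rewrite !mxE.
under eq_bigr => k _ do rewrite mxE scaler_sumr.
rewrite exchange_big; apply: eq_bigr => k _ /=; rewrite mxE scaler_sumr.
by apply: eq_bigr => l _; rewrite !scalerA mulrC.
Qed.

Lemma lmulmxDr m n p (a : 'M_(m, n)) : {morph @lmulmx m n p a : w z / w + z}.
Proof.
move=> w z; apply/matrixP => i j; rewrite !mxE -big_split.
by apply: eq_bigr => k _; rewrite mxE scalerDr.
Qed.

Lemma lmulmx1 n p (w : 'M_(n, p)) : lmulmx 1%:M w = w.
Proof.
apply/matrixP => i j; rewrite mxE (bigD1 i) //= mxE eqxx scale1r.
by rewrite big1 ?addr0 // => k ki; rewrite mxE eq_sym (negbTE ki) scale0r.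
Qed.

Lemma rmulmx1 m n (w : 'M_(m, n)) : rmulmx w 1%:M = w.
Proof.
apply/matrixP => i j; rewrite mxE (bigD1 j) //= mxE eqxx scale1r.
by rewrite big1 ?addr0 // => k ki; rewrite mxE (negbTE ki) scale0r.
Qed.

Lemma rmulmxDl m n p (a : 'M_(n, p)) : {morph (@rmulmx m n p)^~ a : w z / w + z}.
Proof.
move=> w z; apply/matrixP => i j; rewrite !mxE -big_split.
by apply: eq_bigr => k _; rewrite mxE scalerDr.
Qed.

Lemma rmulmxDr m n p (w : 'M_(m, n)) : {morph @rmulmx m n p w : a b / a + b}.
Proof.
move=> a b; apply/matrixP => i j; rewrite !mxE -big_split.
by apply: eq_bigr => k _; rewrite mxE scalerDl.
Qed.

End ModuleMatrices.

(** * Matrices of differential forms *)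

Section Forms.
Variables (K : fieldType) (X : topologicalType) (T : diffTriad K X).
Local Notation Omega := (dt_form T).

Lemma dt_d0 (U : opens X) : dt_d (0 : T U) = 0.
Proof. exact: morph_add0 (@dt_dD _ _ T U). Qed.

Lemma dt_d1 (U : opens X) : dt_d (1 : T U) = 0.
Proof.
by apply: (addrI (dt_d (1 : T U))); rewrite addr0 -{3}[1]mulr1 dt_leibniz !scale1r.
Qed.

(** With this, K-linearity of a connection follows from its Leibniz rule. *)
Lemma dt_d_const (U : opens X) (k : K) : dt_d (alg_in T U k) = 0.
Proof. by rewrite -[alg_in T U k]mulr1 dt_dZ dt_d1 scaler0. Qed.

Section Dmx.
Variable U : opens X.

Definition dmx m n (a : 'M[T U]_(m, n)) : 'M[Omega U]_(m, n) := map_mx (@dt_d _ _ T U) a.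

Lemma dmxD m n : {morph @dmx m n : a b / a + b}.
Proof. by move=> a b; apply/matrixP => i j; rewrite !mxE dt_dD. Qed.

Lemma dmxM m n p (a : 'M[T U]_(m, n)) (b : 'M[T U]_(n, p)) :
  dmx (a *m b) = lmulmx a (dmx b) + rmulmx (dmx a) b.
Proof.
apply/matrixP => i j; rewrite !mxE (big_morph _ (@dt_dD _ _ T U) (dt_d0 U)).
by rewrite -big_split; apply: eq_bigr => k _; rewrite dt_leibniz !mxE.
Qed.

Lemma dmx1 n : dmx (1%:M : 'M[T U]_n) = 0.
Proof. by apply/matrixP => i j; rewrite !mxE; case: eqP; rewrite ?dt_d1 ?dt_d0. Qed.

Lemma dmx_delta n p i0 j0 : dmx (delta_mx i0 j0 : 'M[T U]_(n, p)) = 0.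
Proof. by apply/matrixP => i j; rewrite !mxE; case: andP; rewrite ?dt_d1 ?dt_d0. Qed.

End Dmx.

Section Entries.
Variable n : nat.
Local Notation Mn := (mx_sheaf T n n).
Variables i j : 'I_n.

Let b (V : opens X) (theta : Omega V) (a : Mn V) : Omega V := (a : 'M_n) i j *: theta.

Let bDl V (t t' : Omega V) (a : Mn V) : b (t + t') a = b t a + b t' a.
Proof. exact: scalerDr. Qed.

Let bDr V (t : Omega V) (a a' : Mn V) : b t (a + a') = b t a + b t a'.
Proof. by rewrite /b mxE scalerDl. Qed.

Let b_bal V (c : T V) (t : Omega V) (a : Mn V) : b (c *: t) a = b t (c *: a).
Proof. by rewrite /b mxE !scalerA mulrC. Qed.

Let b_res (V W : opens X) (h : W `<=` V) (t : Omega V) (a : Mn V) :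
  mod_res h (b t a) = b (mod_res h t) (mod_res h a).
Proof. by rewrite /b mod_resZ mxE. Qed.

Definition form_entry (U : opens X) : tensor_sheaf Omega Mn U -> Omega U :=
  @tensor_sheaf_lift _ _ _ _ _ _ _ bDl bDr b_bal b_res U.

Lemma form_entry_stens (U : opens X) (t : Omega U) (a : Mn U) :
  form_entry (stens t a) = (a : 'M_n) i j *: t.
Proof. exact: tensor_sheaf_liftE. Qed.

Lemma form_entryD (U : opens X) : {morph @form_entry U : w z / w + z}.
Proof. exact: tensor_sheaf_liftD. Qed.

Lemma form_entry_res (U V : opens X) (h : V `<=` U) w :
  mod_res h (@form_entry U w) = form_entry (mod_res h w).
Proof. exact: tensor_sheaf_lift_res. Qed.

End Entries.

Section FormMatrix.
Variable n : nat.
Local Notation Mn := (mx_sheaf T n n).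

Definition form_mx (U : opens X) (w : tensor_sheaf Omega Mn U) : 'M[Omega U]_n :=
  \matrix_(i, j) form_entry i j w.

Lemma form_mxD (U : opens X) : {morph @form_mx U : w z / w + z}.
Proof. by move=> w z; apply/matrixP => i j; rewrite !mxE form_entryD. Qed.

Lemma form_mx_res (U V : opens X) (h : V `<=` U) w :
  map_mx (mod_res h) (@form_mx U w) = form_mx (mod_res h w).
Proof. by apply/matrixP => i j; rewrite !mxE form_entry_res. Qed.

Lemma mx_formK (U : opens X) : cancel (@mx_form _ _ T n U) (@form_mx U).
Proof.
move=> theta; apply/matrixP => i j; rewrite mxE /mx_form.
have fD := form_entryD i j; have f0 (V : opens X) := morph_add0 (fD V).
rewrite (big_morph _ (fD U) (f0 U)) (bigD1 i) //= (big_morph _ (fD U) (f0 U)) (bigD1 j) //=.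
rewrite form_entry_stens mxE !eqxx scale1r !big1 ?addr0 // => k kP.
  rewrite (big_morph _ (fD U) (f0 U)) big1 // => l _.
  by rewrite form_entry_stens mxE eq_sym (negbTE kP) scale0r.
by rewrite form_entry_stens mxE eqxx eq_sym (negbTE kP) scale0r.
Qed.

Lemma mx_formD (U : opens X) : {morph @mx_form _ _ T n U : v w / v + w}.
Proof.
move=> v w; rewrite /mx_form -big_split; apply: eq_bigr => i _.
by rewrite -big_split; apply: eq_bigr => j _; rewrite mxE stensDl.
Qed.

Lemma mx_form_res (U V : opens X) (h : V `<=` U) (theta : 'M[Omega U]_n) :
  mod_res h (mx_form theta) = mx_form (map_mx (mod_res h) theta).
Proof.
rewrite /mx_form raddf_sum; apply: eq_bigr => i _.
rewrite raddf_sum; apply: eq_bigr => j _.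
by rewrite [LHS]stens_res mxE /= /mx_res map_delta_mx.
Qed.

(** A section t (x) a is sent to the sum over i, j of (a_ij t) (x) E_ij, and the
    scalars a_ij may be moved to the other factor. *)
Lemma form_mxK (U : opens X) : cancel (@form_mx U) (@mx_form _ _ T n U).
Proof.
pose f (V : opens X) (h : V `<=` U) (w : tensor_sheaf Omega Mn V) := mx_form (form_mx w).
apply: (@tensor_sheaf_ext _ _ _ _ _ _ U f (fun _ _ => id)) => // [V h w z|V W h k l w|V h t a].
- by rewrite /f form_mxD mx_formD.
- by rewrite /f mx_form_res form_mx_res.
rewrite /f /mx_form {2}(matrix_sum_delta (a : 'M_n)) stens_sumr.
apply: eq_bigr => i _; rewrite stens_sumr; apply: eq_bigr => j _.
by rewrite mxE form_entry_stens stens_bal.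
Qed.

End FormMatrix.
End Forms.

(** * Matrices of forms attached to the connection on the principal sheaf *)

Section RepForm.
Variables (K : fieldType) (X : topologicalType) (T : diffTriad K X).
Variables (G : lieTypeGroup T) (n : nat) (phi : lieTypeRep G n).
Local Notation Omega := (dt_form T).
Local Notation Mn := (mx_sheaf T n n).

(** The map 1 (x) phibar, followed by the identification with matrices of forms. *)
Definition rep_form (U : opens X) (w : tensor_sheaf Omega (lt_lie G) U) : 'M[Omega U]_n :=
  form_mx (one_tensor Omega (modHom_on U (ltr_bar phi)) w).

Lemma rep_formD (U : opens X) : {morph @rep_form U : w z / w + z}.
Proof. by move=> w z; rewrite /rep_form one_tensorD form_mxD. Qed.

Lemma rep_form_res (U V : opens X) (h : V `<=` U) w :
  map_mx (mod_res h) (@rep_form U w) = rep_form (mod_res h w).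
Proof.
rewrite /rep_form form_mx_res; congr form_mx.
exact: one_tensor_res.
Qed.

Lemma rep_form_stens (U : opens X) (t : Omega U) (u : lt_lie G U) i j :
  rep_form (stens t u) i j = (ltr_bar phi U u : 'M_n) i j *: t.
Proof. by rewrite mxE one_tensorE form_entry_stens. Qed.

(** On t (x) u this is the compatibility of phibar with rho and the adjoint
    representation.  To conclude by [tensor_sheaf_ext], both sides have to be
    seen as families of maps over all open subsets of [U], with [g] restricted
    to each of them. *)
Lemma rep_form_rho (U : opens X) (g : G U) w :
  rep_form (one_tensor Omega (lt_rho G U g) w) =
  lmulmx (phi_mx phi g) (rmulmx (rep_form w) (phi_mx phi (g^-1)%g)).
Proof.
apply/matrixP => i j.
pose f (V : opens X) (h : V `<=` U) (w : tensor_sheaf Omega (lt_lie G) V) : Omega V :=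
  rep_form (one_tensor Omega (lt_rho G V (gs_res h g)) w) i j.
pose f' (V : opens X) (h : V `<=` U) (w : tensor_sheaf Omega (lt_lie G) V) : Omega V :=
  lmulmx (phi_mx phi (gs_res h g))
    (rmulmx (rep_form w) (phi_mx phi (gs_res h g)^-1%g)) i j.
have ff' : forall V h z, f V h z = f' V h z.
  apply: tensor_sheaf_ext => [V h w1 w2|V h w1 w2|V W h k l z|V W h k l z|V h t u].
  - by rewrite /f one_tensorD rep_formD mxE.
  - by rewrite /f' rep_formD rmulmxDl lmulmxDr mxE.
  - rewrite /f -(one_tensor_res (f := lt_rho G V (gs_res h g))) -?rep_form_res ?mxE //.
    by move=> Z hV hW v; rewrite !(lr_res _ _ _ (subset_trans hW l)).
  - rewrite /f' -(res_comp (@gsP _ G) h k l) -(mult_morphV (gs_res k)).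
    rewrite -!phi_mx_res -rep_form_res !mxE raddf_sum; apply: eq_bigr => c _.
    rewrite mod_resZ !mxE raddf_sum; congr (_ *: _); apply: eq_bigr => d _.
    by rewrite mod_resZ !mxE.
  rewrite /f one_tensorE rep_form_stens ltr_Ad /f' /= /Ad_fun -(mult_morphV (phi V)).
  rewrite !(res_id (mx_sheaf_axiom T n n)) -mulmxA !mxE scaler_suml.
  apply: eq_bigr => c _; rewrite -scalerA !mxE scaler_suml; congr (_ *: _).
  by apply: eq_bigr => d _; rewrite rep_form_stens scalerA mulrC.
move: (ff' U (fun _ h => h) w).
by rewrite /f /f' (res_id (@gsP _ G)).
Qed.

Lemma rep_form_del (U : opens X) (g : G U) :
  rep_form (lt_del g) = lmulmx (phi_mx phi (g^-1)%g) (dmx (phi_mx phi g)).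
Proof.
rewrite /rep_form -ltr_del /gl_del mx_formK; apply/matrixP => i j; rewrite !mxE.
by apply: eq_bigr => k _; rewrite mxE /phi_mx mult_morphV.
Qed.

Section ConnectionMatrix.
Variables (P : principalSheaf G) (D : connection P).

Definition conn_mx (U : opens X) (p : P U) : 'M[Omega U]_n := rep_form (D U p).

Lemma conn_mx_res (U V : opens X) (h : V `<=` U) (p : P U) :
  map_mx (mod_res h) (conn_mx p) = conn_mx (sh_res h p).
Proof. by rewrite /conn_mx rep_form_res conn_res. Qed.

(** The transformation law of D under the action of G becomes the classical
    change of gauge, its two terms being given by [rep_form_rho] and
    [rep_form_del]. *)
Lemma conn_mx_act (U : opens X) (p : P U) (g : G U) :
  conn_mx (ps_act p g) =
  lmulmx (phi_mx phi (g^-1)%g) (rmulmx (conn_mx p) (phi_mx phi g) + dmx (phi_mx phi g)).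
Proof.
by rewrite /conn_mx conn_act rep_formD rep_form_rho rep_form_del invgK lmulmxDr.
Qed.

End ConnectionMatrix.

End RepForm.

(** * The covariant derivative in a local frame *)

Section LocalNabla.
Variables (K : fieldType) (X : topologicalType) (T : diffTriad K X).
Variables (G : lieTypeGroup T) (P : principalSheaf G) (n : nat) (phi : lieTypeRep G n).
Local Notation Omega := (dt_form T).
Local Notation E := (assoc_sheaf P phi).

(** Equality of sections is local, and the trivializing open sets cover the
    base; hence calculations may be made where a natural section exists. *)
Lemma chart_ext (S : modSheaf T) (U : opens X) (s t : S U) :
  (forall (alpha : ps_idx P) (V : opens X) (h : V `<=` U) (ha : V `<=` ps_cov alpha),
    mod_res h s = mod_res h t) -> s = t.
Proof.
move=> st; apply: (sheaf_sep (msP S)) => x Ux; have [alpha ax] := ps_covP P x.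
by exists (openI U (ps_cov alpha)), openIl; split; last exact: st openIr.
Qed.

(** The class [[p, v]]; [assoc_psi] is the case where [p] restricts a natural section. *)
Definition bracket (U : opens X) (p : P U) (v : 'cV[T U]_n) : E U :=
  @eta X (assoc_presheaf P phi) U (assoc_cls phi p v).

Lemma bracket_res (U V : opens X) (h : V `<=` U) (p : P U) v :
  mod_res h (bracket p v) = bracket (sh_res h p) (mx_res h v).
Proof. by rewrite [LHS]eta_res /= assoc_presE. Qed.

Lemma bracket_act (U : opens X) (p : P U) (g : G U) v :
  bracket (ps_act p g) v = bracket p (phi_mx phi g *m v).
Proof.
congr eta; apply/esym; apply/(cls_eq (assoc_rel_equiv P phi U)).
by apply: (assoc_relI (g := g)) => //=; rewrite mulmxA -phi_mxM mulVg phi_mx1 mul1mx.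
Qed.

(** Only over a trivializing open set is the module structure of E given by
    coordinates; there [p] differs from the natural section by some [g], and
    [phi g] acts linearly on the coordinates. *)
Lemma bracket_linear (U : opens X) (p : P U) : linear (bracket p).
Proof.
move=> a v w; apply: chart_ext => alpha V h ha.
rewrite raddfD mod_resZ !bracket_res.
have [g ->] := ps_act_trans ha (sh_res ha (nat_sec alpha)) (sh_res h p).
rewrite !bracket_act -[RHS](linearP (assoc_psi phi ha)); congr (assoc_psi phi ha _).
by rewrite raddfD /= mx_resZ mulmxDr -scalemxAr.
Qed.

HB.instance Definition _ (U : opens X) (p : P U) :=
  GRing.isLinear.Build (T U) 'cV[T U]_n (E U) _ (bracket p) (bracket_linear p).

(** The element of E (x) Omega whose coordinates in the frame [[p, e_j]] are [v]. *)
Definition frame_sum (U : opens X) (p : P U) (v : 'cV[Omega U]_n) : tensor_sheaf E Omega U :=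
  \sum_j stens (bracket p (delta_mx j 0)) (v j 0).

Lemma frame_sumD (U : opens X) (p : P U) : {morph frame_sum p : v w / v + w}.
Proof.
by move=> v w; rewrite /frame_sum -big_split; apply: eq_bigr => j _; rewrite mxE stensDr.
Qed.

Lemma frame_sum_res (U V : opens X) (h : V `<=` U) (p : P U) v :
  mod_res h (frame_sum p v) = frame_sum (sh_res h p) (map_mx (mod_res h) v).
Proof.
rewrite /frame_sum raddf_sum; apply: eq_bigr => j _.
by rewrite [LHS]stens_res bracket_res mxE /mx_res map_delta_mx.
Qed.

Lemma bracket_sum (U : opens X) (p : P U) v :
  bracket p v = \sum_j v j 0 *: bracket p (delta_mx j 0).
Proof.
rewrite {1}[v]matrix_sum_delta raddf_sum; apply: eq_bigr => j _.
by rewrite big_ord1 /= linearZ.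
Qed.

Lemma frame_sum_act (U : opens X) (p : P U) (g : G U) v :
  frame_sum (ps_act p g) v = frame_sum p (lmulmx (phi_mx phi g) v).
Proof.
rewrite /frame_sum.
under eq_bigr => j _ do rewrite bracket_act bracket_sum stens_suml.
rewrite exchange_big; apply: eq_bigr => i _ /=; rewrite mxE stens_sumr.
apply: eq_bigr => j _; rewrite stens_bal; congr (stens _ (_ *: _)).
by rewrite -colE mxE.
Qed.

Variable D : connection P.

(** The expression of the covariant derivative in the frame of [p]. *)
Definition cov_der (U : opens X) (p : P U) (f : 'cV[T U]_n) : tensor_sheaf E Omega U :=
  frame_sum p (dmx f + rmulmx (conn_mx phi D p) f).

(** The change of gauge, with a = phi(g) and h its inverse:
    a (d (h f) + h (theta a + d a) h f) = d f + theta f + (a (d h) + (d a) h) f,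
    where the last term is d (a h) f = 0. *)
Lemma cov_der_act (U : opens X) (p : P U) (g : G U) f :
  cov_der (ps_act p g) (phi_mx phi (g^-1)%g *m f) = cov_der p f.
Proof.
rewrite /cov_der frame_sum_act conn_mx_act dmxM; congr frame_sum.
set h := phi_mx phi (g^-1)%g; set a := phi_mx phi g.
have ah : a *m h = 1%:M by rewrite -phi_mxM mulgV phi_mx1.
rewrite !(lmulmxDr, =^~ lrmulmxA, lmulmxA) ah !lmulmx1 -!rmulmxA.
rewrite [rmulmx (_ + _) h]rmulmxDl rmulmxA ah rmulmx1 rmulmxDl.
rewrite addrACA -(rmulmxDl f (lmulmx a (dmx h))) -dmxM ah dmx1.
by rewrite (morph_add0 (rmulmxDl f)) addr0.
Qed.

Lemma cov_der_res (U V : opens X) (h : V `<=` U) (p : P U) f :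
  mod_res h (cov_der p f) = cov_der (sh_res h p) (mx_res h f).
Proof.
rewrite /cov_der frame_sum_res; congr frame_sum.
rewrite -conn_mx_res; apply/matrixP => i j; rewrite !mxE raddfD /= dt_d_res raddf_sum.
by congr (_ + _); apply: eq_bigr => k _; rewrite !mxE mod_resZ.
Qed.

Lemma cov_derD (U : opens X) (p : P U) : {morph cov_der p : f f' / f + f'}.
Proof. by move=> f f'; rewrite /cov_der dmxD rmulmxDr addrACA -frame_sumD. Qed.

Lemma cov_derZ (U : opens X) (p : P U) (a : T U) f :
  cov_der p (a *: f) = a *: cov_der p f + stens (bracket p f) (dt_d a).
Proof.
rewrite bracket_sum stens_suml scaler_sumr -big_split; apply: eq_bigr => j _ /=.
rewrite stens_bal -stensZr -stensDr; congr stens; rewrite !mxE dt_leibniz scalerDr.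
rewrite scaler_sumr addrAC; congr (_ + _ + _).
by apply: eq_bigr => k _; rewrite mxE scalerA.
Qed.

End LocalNabla.

(** * The induced connection *)

Section InducedConnection.
Variables (K : fieldType) (X : topologicalType) (T : diffTriad K X).
Variables (G : lieTypeGroup T) (P : principalSheaf G) (n : nat) (phi : lieTypeRep G n).
Variable D : connection P.
Local Notation Omega := (dt_form T).
Local Notation E := (assoc_sheaf P phi).
Local Notation EOmega := (tensor_sheaf E Omega).

(** Taking any representative of the class is harmless by [cov_der_act]. *)
Definition quot_der (U : opens X) (q : assoc_quot P phi U) : EOmega U :=
  cov_der phi D (repr q).1 (repr q).2.

Lemma quot_derE (U : opens X) (p : P U) f : quot_der (assoc_cls phi p f) = cov_der phi D p f.
Proof.
have [g [[e1 e2] _]] := repr_cls (assoc_rel_equiv P phi U) (p, f).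
move: e1 e2; rewrite /quot_der -/(assoc_cls phi p f).
by case: (repr _) => p' f' /= -> ->; rewrite cov_der_act.
Qed.

Lemma quot_der_res (U V : opens X) (h : V `<=` U) (q : assoc_presheaf P phi U) :
  mod_res h (quot_der q) = quot_der (pres h q).
Proof. by rewrite /pres /= /assoc_pres quot_derE cov_der_res. Qed.

Definition nabla_sec (U : opens X) (s : E U) : EOmega U :=
  gen_lift (msP EOmega) quot_der_res s.

Lemma nabla_sec_bracket (U : opens X) (p : P U) f :
  nabla_sec (bracket phi p f) = cov_der phi D p f.
Proof. by rewrite -quot_derE; exact: gen_lift_eta. Qed.

Lemma nabla_sec_res (U V : opens X) (h : V `<=` U) (s : E U) :
  mod_res h (nabla_sec s) = nabla_sec (mod_res h s).
Proof. exact: gen_lift_res. Qed.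

Lemma nabla_secD (U : opens X) : {morph @nabla_sec U : s t / s + t}.
Proof.
move=> s t; apply: (chart_ext (P := P)) => alpha V h ha.
rewrite raddfD /= !nabla_sec_res raddfD /=.
have [f <-] := assoc_psi_surj ha (mod_res h s).
have [f' <-] := assoc_psi_surj ha (mod_res h t).
by rewrite -raddfD !nabla_sec_bracket cov_derD.
Qed.

Lemma nabla_sec_leibniz (U : opens X) (a : T U) (s : E U) :
  nabla_sec (a *: s) = a *: nabla_sec s + stens s (dt_d a).
Proof.
apply: (chart_ext (P := P)) => alpha V h ha.
rewrite raddfD [mod_res _ (stens _ _)]stens_res mod_resZ !nabla_sec_res mod_resZ dt_d_res.
have [f <-] := assoc_psi_surj ha (mod_res h s).
by rewrite -linearZ !nabla_sec_bracket cov_derZ.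
Qed.

Lemma nabla_secZ (U : opens X) (k : K) (s : E U) :
  nabla_sec (alg_in T U k *: s) = alg_in T U k *: nabla_sec s.
Proof. by rewrite nabla_sec_leibniz dt_d_const stens0r addr0. Qed.

Definition induced_connection : linConnection E :=
  LinConnection nabla_sec_res nabla_secD nabla_secZ nabla_sec_leibniz.

Lemma assoc_frameE (alpha : ps_idx P) (j : 'I_n) :
  assoc_frame phi alpha j = bracket phi (nat_sec alpha) (delta_mx j 0).
Proof. by rewrite /assoc_frame /assoc_psi (res_id (shP P)). Qed.

Lemma induced_conn_matrix (alpha : ps_idx P) :
  is_conn_matrix induced_connection (conn_mx phi D (nat_sec alpha)).
Proof.
move=> j; rewrite assoc_frameE /= nabla_sec_bracket /cov_der dmx_delta add0r.
apply: eq_bigr => i _; rewrite assoc_frameE; congr stens.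
rewrite mxE (bigD1 j) //= mxE !eqxx scale1r big1 ?addr0 // => k kj.
by rewrite mxE (negbTE kj) scale0r.
Qed.

Lemma induced_connectionP : induces D induced_connection.
Proof.
move=> alpha; exists (conn_mx phi D (nat_sec alpha)); first exact: induced_conn_matrix.
exact: form_mxK.
Qed.

Lemma linConnection_eq (F : modSheaf T) (nabla nabla' : linConnection F) :
  (forall U (s : F U), nabla U s = nabla' U s) -> nabla = nabla'.
Proof.
case: nabla => f r d z l; case: nabla' => f' r' d' z' l' /= e.
have ff' : f = f'.
  apply: functional_extensionality_dep => U.
  by apply: functional_extensionality_dep => s; exact: e.
by subst f'; congr LinConnection; exact: Prop_irrelevance.
Qed.

(** Locally a section is a combination of the frame, and the Leibniz rule gives
    the value of a connection on a combination. *)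
Lemma linConnection_frame_ext (nabla nabla' : linConnection E) :
  (forall (alpha : ps_idx P) j,
    nabla _ (assoc_frame phi alpha j) = nabla' _ (assoc_frame phi alpha j)) ->
  nabla = nabla'.
Proof.
move=> eq_frame; apply: linConnection_eq => U s.
apply: (chart_ext (P := P)) => alpha V h ha.
rewrite !nabla_res.
have [f <-] := assoc_psi_surj ha (mod_res h s).
rewrite [assoc_psi _ _ _](bracket_sum phi (sh_res ha (nat_sec alpha))).
pose nD (N : linConnection E) :=
  big_morph _ (@nablaD _ _ _ _ N V) (morph_add0 (@nablaD _ _ _ _ N V)).
rewrite !nD; apply: eq_bigr => j _; rewrite !nabla_leibniz; congr (_ *: _ + _).
have -> : bracket phi (sh_res ha (nat_sec alpha)) (delta_mx j 0) =
    mod_res ha (assoc_frame phi alpha j).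
  by rewrite assoc_frameE bracket_res /mx_res map_delta_mx.
by rewrite -!nabla_res eq_frame.
Qed.

(** The condition fixes the matrix theta of a connection form only through
    [mx_form theta]; as [mx_form] is injective, the values on the frames agree. *)
Lemma induces_unique (nabla : linConnection E) : induces D nabla -> induced_connection = nabla.
Proof.
move=> ind; apply: linConnection_frame_ext => alpha j.
have [theta -> e] := ind alpha; rewrite induced_conn_matrix.
by rewrite -[theta]mx_formK e.
Qed.

End InducedConnection.

Theorem theorem3 (R : realType) (K : fieldType) (hK : real_or_complex R K)
    (X : topologicalType) (T : diffTriad K X) (G : lieTypeGroup T)
    (P : principalSheaf G) (n : nat) (phi : lieTypeRep G n)
    (D : connection P) :
  exists! nabla : linConnection (assoc_sheaf P phi), induces D nabla.
Proof.
exists (induced_connection phi D); split; first exact: induced_connectionP.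
exact: induces_unique.
Qed.
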